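(* Let $\mathcal M=\{A,B,C,D\}$ be a strictly passive and minimal discrete-time model, and let $$\Xi:=\sup\{\xi<1:\ \mathcal T_\xi(z)\ \text{is strictly passive}\}.$$ Then $\Xi$ is a finite (bounded) supremum and, with $\mathcal M_\Xi$ defined by the formula below, (1) $\mathcal T_\Xi(z)$ is passive; (2) the set $\{X\in\mathbb H_n:\widetilde W(X,\mathcal M_\Xi)\ge0\}$ is nonempty; (3) the set $\{X\in\mathbb H_n:\widetilde W(X,\mathcal M_\Xi)>0\}$ is empty; (4) for every $\xi<\Xi$ the set $\{X\in\mathbb H_n:\widetilde W(X,\mathcal M_\xi)>0\}$ is nonempty; (5) $\Xi=\sup_{X\in\mathbb X^{>}(\mathcal M)}\xi^*(X)$.
   Context: A discrete-time model is $\mathcal M=\{A,B,C,D\}$ with $A\in\mathbb C^{n\times n}$, $B\in\mathbb C^{n\times m}$, $C\in\mathbb C^{m\times n}$, $D\in\mathbb C^{m\times m}$, transfer function $\mathcal T(z)=C(zI_n-A)^{-1}B+D$; minimal means $(A,B)$ controllable and $(A,C)$ observable. A transfer function $\mathcal T$ with realization matrix $A$ is passive if $\mathcal T(e^{\imath\omega})^{\mathsf H}+\mathcal T(e^{\imath\omega})\ge0$ for all $\omega\in[-\pi,\pi]$ and the eigenvalues of $A$ lie in the closed unit disc with those on the unit circle semisimple; it is strictly passive if $\mathcal T(e^{\imath\omega})^{\mathsf H}+\mathcal T(e^{\imath\omega})>0$ for all $\omega$ and all eigenvalues of $A$ lie in the open unit disc. For real $\xi\neq1$, $\mathcal M_\xi=\{A_\xi,B_\xi,C_\xi,D_\xi\}=\{\tfrac{A}{1-\xi},\tfrac{B}{1-\xi},\tfrac{C}{1-\xi},\tfrac{D-\xi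 I_m}{1-\xi}\}$ and $\mathcal T_\xi(z)=C_\xi(zI_n-A_\xi)^{-1}B_\xi+D_\xi$. $\mathbb H_n$ is the set of $n\times n$ Hermitian matrices. For $X\in\mathbb H_n$ and a model $\mathcal N=\{A',B',C',D'\}$, $$W(X,\mathcal N)=\begin{bmatrix} X-A'^{\mathsf H}XA' & C'^{\mathsf H}-A'^{\mathsf H}XB'\\ C'-B'^{\mathsf H}XA' & D'^{\mathsf H}+D'-B'^{\mathsf H}XB'\end{bmatrix},\qquad \widetilde W(X,\mathcal N)=\begin{bmatrix} X & XA' & XB'\\ A'^{\mathsf H}X & X & C'^{\mathsf H}\\ B'^{\mathsf H}X & C' & D'^{\mathsf H}+D'\end{bmatrix}.$$ $\mathbb X^{>}(\mathcal M)=\{X\in\mathbb H_n: W(X,\mathcal M)\ge0,\ X>0\}$, and for $X\in\mathbb X^{>}(\mathcal M)$, $\xi^*(X)$ is the largest real $\xi$ with $\widetilde W(X,\mathcal M)\ge\xi\operatorname{diag}(X,X,2I_m)$. *)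

(* Defs.v *)
From HB Require Import structures.
From mathcomp Require Import all_boot all_order all_algebra.
From mathcomp Require Import all_classical all_reals.
From mathcomp Require Import trigo.
From mathcomp Require Import complex.

Set Implicit Arguments.
Unset Strict Implicit.
Unset Printing Implicit Defensive.

Import Order.TTheory GRing.Theory Num.Theory.
Local Open Scope ring_scope.
Local Open Scope complex_scope.

Section Defs.
Variable R : realType.
Local Notation C := R[i].

Definition adjmx (p q : nat) (M : 'M[C]_(p, q)) : 'M[C]_(q, p) :=
  (map_mx Num.conj M)^T.

Definition is_hermitian (p : nat) (M : 'M[C]_p) : Prop := adjmx M = M.

Definition psd (p : nat) (M : 'M[C]_p) : Prop :=
  is_hermitian M /\ forall v : 'cV[C]_p, 0 <= (adjmx v *m M *m v) 0 0.

Definition pd (p : nat) (M : 'M[C]_p) : Prop :=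
  is_hermitian M /\ forall v : 'cV[C]_p, v != 0 -> 0 < (adjmx v *m M *m v) 0 0.

Record model (n m : nat) := Model {
  mA : 'M[C]_n; mB : 'M[C]_(n, m); mC : 'M[C]_(m, n); mD : 'M[C]_m }.

Definition tf n m (M : model n m) (z : C) : 'M[C]_m :=
  mC M *m invmx (z%:M - mA M) *m mB M + mD M.

Definition expi (w : R) : C := (cos w) +i* (sin w).

Definition semisimple n (A : 'M[C]_n) (l : C) : Prop :=
  Pdiv.Field.mup l (char_poly A) = (n - \rank (A - l%:M)%R)%N.

Definition passive n m (M : model n m) : Prop :=
  (forall w : R, - pi <= w <= pi -> ~ eigenvalue (mA M) (expi w) ->
     psd (adjmx (tf M (expi w)) + tf M (expi w))) /\
  (forall l : C, eigenvalue (mA M) l -> `|l| <= 1) /\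
  (forall l : C, eigenvalue (mA M) l -> `|l| = 1 -> semisimple (mA M) l).

Definition strictly_passive n m (M : model n m) : Prop :=
  (forall w : R, - pi <= w <= pi ->
     pd (adjmx (tf M (expi w)) + tf M (expi w))) /\
  (forall l : C, eigenvalue (mA M) l -> `|l| < 1).

Definition controllable n m (A : 'M[C]_n) (B : 'M[C]_(n, m)) : Prop :=
  \rank (\mxrow_(i < n) (A ^+ i *m B)) = n.

Definition observable n m (A : 'M[C]_n) (Cm : 'M[C]_(m, n)) : Prop :=
  \rank (\mxcol_(i < n) (Cm *m A ^+ i)) = n.

Definition minimal n m (M : model n m) : Prop :=
  controllable (mA M) (mB M) /\ observable (mA M) (mC M).

Definition model_xi n m (M : model n m) (xi : R) : model n m :=
  Model ((1 - xi)^-1%:C *: mA M) ((1 - xi)^-1%:C *: mB M)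
        ((1 - xi)^-1%:C *: mC M) ((1 - xi)^-1%:C *: (mD M - xi%:C%:M)).

Definition Wmx n m (X : 'M[C]_n) (N : model n m) : 'M[C]_(n + m) :=
  block_mx (X - adjmx (mA N) *m X *m mA N) (adjmx (mC N) - adjmx (mA N) *m X *m mB N)
           (mC N - adjmx (mB N) *m X *m mA N)
           (adjmx (mD N) + mD N - adjmx (mB N) *m X *m mB N).

Definition Wtmx n m (X : 'M[C]_n) (N : model n m) : 'M[C]_(n + n + m) :=
  block_mx (block_mx X (X *m mA N) (adjmx (mA N) *m X) X)
           (col_mx (X *m mB N) (adjmx (mC N)))
           (row_mx (adjmx (mB N) *m X) (mC N))
           (adjmx (mD N) + mD N).

Definition diagXX2 n m (X : 'M[C]_n) : 'M[C]_(n + n + m) :=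
  block_mx (block_mx X 0 0 X) 0 0 (2%:R%:M).

Definition Xgt n m (M : model n m) : set 'M[C]_n :=
  [set X | is_hermitian X /\ psd (Wmx X M) /\ pd X].

Definition xi_star n m (M : model n m) (X : 'M[C]_n) : R :=
  sup [set xi : R | psd (Wtmx X M - xi%:C *: diagXX2 m X)].

Definition sp_set n m (M : model n m) : set R :=
  [set xi : R | xi < 1 /\ strictly_passive (model_xi M xi)].

Definition Xi n m (M : model n m) : R := sup (sp_set M).

End Defs.

(* Main.v *)
Require Import Defs.
From HB Require Import structures.
From mathcomp Require Import all_boot all_order all_algebra.
From mathcomp Require Import all_classical all_reals.
From mathcomp Require Import topology normedtype sequences trigo.
From mathcomp Require Import complex.
From mathcomp Require Import ring lra.

(* Schur complementation with respect to the block [X] turns [Wtmx X N > 0] into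
   [X > 0] and [Wmx X N > 0], and [(1 - xi) Wtmx X (M_xi)] equals
   [Wtmx X M - xi diag (X, X, 2)]. By the strict Kalman-Yakubovich-Popov lemma,
   [xi < 1] therefore belongs to [sp_set M] iff [Wtmx X M > xi diag (X, X, 2)]
   for some [X > 0]; these [xi] form an open down-set.

   The KYP lemma is proved by duality. If the LMI were infeasible, a minimal norm
   argument would give [Z >= 0], [Z <> 0], with [Z_11 = [A B] Z [A B]^*] and
   [<W(0), Z> <= 0]. Such a [Z] is a sum of terms [g g^*] with [g = (x, u)] and
   [A x + B u = l x], [|l| = 1], on which [W(0)] takes the value
   [u^* (T(l)^* + T(l)) u], contradicting strict passivity.

   Feasible [X] are bounded by controllability, so a solution survives at [Xi],
   where it is definite by observability. If [Xi] were [1], the LMI would force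
   all Markov parameters [C A^k B] to vanish, contradicting minimality. *)

Set Implicit Arguments.
Unset Strict Implicit.
Unset Printing Implicit Defensive.

Import Order.TTheory GRing.Theory Num.Theory.
Local Open Scope ring_scope.

(** * Real parts of sesquilinear forms *)

(** Duality is run on the unit-trace slice of the positive semidefinite cone. The slice is compact
    and the inequalities are strict, so the least norm is attained and no closure of a cone has to
    be described. The price is that the separating functional is only a Hermitian [X] with a
    multiplier [tau >= 0]. Both [X > 0] and [tau > 0] are recovered from stability of [A]: for
    [u = 0] the inequality is a Stein inequality, which forces [X > 0], and then [tau = 0] fails on
    inputs acting from the zero state. A solution at [Xi] is a limit of solutions below it, so these
    need bounds that do not depend on [X]; they come from [D^* + D], in which [X] does not occur.
    Compactness is used through one ultrafilter on [nat] along which all matrix entries converge at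
    once, so no subsequences are extracted. [Xi < 1] has to precede every statement about the model
    at [Xi], because the passage between that model and the inequality for [M] multiplies by
    [1 - xi]. *)

(* Working with the real part turns a Hermitian form into a symmetric
   real-bilinear one, so that inequalities live in the ordered field [R]. *)
HB.lock Definition rform (R : realType) (p q : nat) (X : 'M[R[i]%C]_(p, q))
    (u : 'cV[R[i]%C]_p) (v : 'cV[R[i]%C]_q) : R :=
  complex.Re ((adjmx u *m X *m v) 0 0).

Section Forms.
Variable R : realType.
Local Notation C := (complex R).
Local Notation Re := (@complex.Re R).
Local Notation Im := (@complex.Im R).

Lemma adjmxE p q (M : 'M[C]_(p, q)) i j : adjmx M i j = (M j i)^*.
Proof. by rewrite !mxE. Qed.

Lemma adjmxK p q (M : 'M[C]_(p, q)) : adjmx (adjmx M) = M.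
Proof. by apply/matrixP => i j; rewrite !adjmxE conjCK. Qed.

Lemma adjmxM p q r (M : 'M[C]_(p, q)) (N : 'M[C]_(q, r)) :
  adjmx (M *m N) = adjmx N *m adjmx M.
Proof. by rewrite /adjmx map_mxM trmx_mul. Qed.

Lemma adjmxD p q (M N : 'M[C]_(p, q)) : adjmx (M + N) = adjmx M + adjmx N.
Proof. by rewrite /adjmx map_mxD linearD. Qed.

Lemma adjmxB p q (M N : 'M[C]_(p, q)) : adjmx (M - N) = adjmx M - adjmx N.
Proof. by rewrite /adjmx map_mxB linearB. Qed.

Lemma adjmx0 p q : adjmx (0 : 'M[C]_(p, q)) = 0.
Proof. by rewrite /adjmx map_mx0 trmx0. Qed.

Lemma adjmx1 p : adjmx (1%:M : 'M[C]_p) = 1%:M.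
Proof. by rewrite /adjmx map_mx1 trmx1. Qed.

Lemma adjmxZ p q (c : C) (M : 'M[C]_(p, q)) : adjmx (c *: M) = c^* *: adjmx M.
Proof. by rewrite /adjmx map_mxZ linearZ. Qed.

Lemma conj_real (x : R) : (x%:C%C)^* = x%:C%C :> C.
Proof. by rewrite conj_Creal // complex_real. Qed.

Lemma adjmxZr p q (c : R) (M : 'M[C]_(p, q)) :
  adjmx (c%:C%C *: M) = c%:C%C *: adjmx M.
Proof. by rewrite adjmxZ conj_real. Qed.

Lemma adjmx_scalar_real p (c : R) :
  adjmx (c%:C%C%:M : 'M[C]_p) = c%:C%C%:M.
Proof. by rewrite -scalemx1 adjmxZr adjmx1. Qed.

Lemma adj_row_mx p q r (M : 'M[C]_(p, q)) (N : 'M[C]_(p, r)) :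
  adjmx (row_mx M N) = col_mx (adjmx M) (adjmx N).
Proof. by rewrite /adjmx map_row_mx tr_row_mx. Qed.

Lemma adj_col_mx p q r (M : 'M[C]_(p, q)) (N : 'M[C]_(r, q)) :
  adjmx (col_mx M N) = row_mx (adjmx M) (adjmx N).
Proof. by rewrite /adjmx map_col_mx tr_col_mx. Qed.

Lemma adj_block_mx p q r s (M1 : 'M[C]_(p, q)) (M2 : 'M[C]_(p, r))
    (M3 : 'M[C]_(s, q)) (M4 : 'M[C]_(s, r)) :
  adjmx (block_mx M1 M2 M3 M4) =
  block_mx (adjmx M1) (adjmx M3) (adjmx M2) (adjmx M4).
Proof. by rewrite /adjmx map_block_mx tr_block_mx. Qed.

Lemma Re_add (x y : C) : Re (x + y) = Re x + Re y.
Proof. by case: x; case: y. Qed.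
Lemma Im_add (x y : C) : Im (x + y) = Im x + Im y.
Proof. by case: x; case: y. Qed.
Lemma Re_mul (x y : C) : Re (x * y) =
  Re x * Re y - Im x * Im y.
Proof. by case: x; case: y. Qed.
Lemma Im_mul (x y : C) : Im (x * y) =
  Re x * Im y + Im x * Re y.
Proof. by case: x; case: y. Qed.
Lemma Re_conjC (x : C) : Re (x^*) = Re x.
Proof. by rewrite -[x^*]/(conjc x); case: x. Qed.
Lemma Im_conjC (x : C) : Im (x^*) = - Im x.
Proof. by rewrite -[x^*]/(conjc x); case: x. Qed.
Lemma complex_eqP (x y : C) : Re x = Re y ->
  Im x = Im y -> x = y.
Proof. by case: x y => a b [c d] /= -> ->. Qed.

Lemma Re_sum (I : Type) (r : seq I) (P : pred I) (F : I -> C) :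
  Re (\sum_(i <- r | P i) F i) = \sum_(i <- r | P i) Re (F i).
Proof. by apply: (big_morph Re) => // x y; rewrite Re_add. Qed.
Lemma rformDl p q (X : 'M[C]_(p, q)) u1 u2 v :
  rform X (u1 + u2) v = rform X u1 v + rform X u2 v.
Proof. by rewrite rform.unlock adjmxD !mulmxDl mxE Re_add. Qed.
Lemma rformDr p q (X : 'M[C]_(p, q)) u v1 v2 :
  rform X u (v1 + v2) = rform X u v1 + rform X u v2.
Proof. by rewrite rform.unlock mulmxDr mxE Re_add. Qed.
Lemma rformDm p q (X Y : 'M[C]_(p, q)) u v :
  rform (X + Y) u v = rform X u v + rform Y u v.
Proof. by rewrite rform.unlock mulmxDr mulmxDl mxE Re_add. Qed.
Lemma rformZl p q (X : 'M[C]_(p, q)) (c : R) u v :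
  rform X (c%:C%C *: u) v = c * rform X u v.
Proof. by rewrite rform.unlock adjmxZr -!scalemxAl mxE Re_mul /= mul0r subr0. Qed.
Lemma rformZr p q (X : 'M[C]_(p, q)) (c : R) u v :
  rform X u (c%:C%C *: v) = c * rform X u v.
Proof. by rewrite rform.unlock -!scalemxAr mxE Re_mul /= mul0r subr0. Qed.
Lemma rformZm p q (X : 'M[C]_(p, q)) (c : R) u v :
  rform (c%:C%C *: X) u v = c * rform X u v.
Proof.
by rewrite rform.unlock -!scalemxAr -!scalemxAl mxE Re_mul /= mul0r subr0.
Qed.
Lemma rformNl p q (X : 'M[C]_(p, q)) u v : rform X (- u) v = - rform X u v.
Proof.
by rewrite -scaleN1r -(rmorphN1 (real_complex R)) rformZl mulN1r.
Qed.
Lemma rformNr p q (X : 'M[C]_(p, q)) u v : rform X u (- v) = - rform X u v.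
Proof. by rewrite -scaleN1r -(rmorphN1 (real_complex R)) rformZr mulN1r. Qed.
Lemma rformNm p q (X : 'M[C]_(p, q)) u v : rform (- X) u v = - rform X u v.
Proof. by rewrite -scaleN1r -(rmorphN1 (real_complex R)) rformZm mulN1r. Qed.
Lemma rformBm p q (X Y : 'M[C]_(p, q)) u v :
  rform (X - Y) u v = rform X u v - rform Y u v.
Proof. by rewrite rformDm rformNm. Qed.
Lemma rform0m p q u v : rform (0 : 'M[C]_(p, q)) u v = 0.
Proof. by rewrite rform.unlock mulmx0 mul0mx mxE. Qed.
Lemma rform0l p q (X : 'M[C]_(p, q)) v : rform X 0 v = 0.
Proof. by rewrite rform.unlock adjmx0 !mul0mx mxE. Qed.
Lemma rform0r p q (X : 'M[C]_(p, q)) u : rform X u 0 = 0.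
Proof. by rewrite rform.unlock mulmx0 mxE. Qed.

Lemma rform_mull p q r (A : 'M[C]_(r, p)) (X : 'M[C]_(r, q)) u v :
  rform (adjmx A *m X) u v = rform X (A *m u) v.
Proof. by rewrite rform.unlock adjmxM !mulmxA. Qed.
Lemma rform_mulr p q r (X : 'M[C]_(p, r)) (A : 'M[C]_(r, q)) u v :
  rform (X *m A) u v = rform X u (A *m v).
Proof. by rewrite rform.unlock !mulmxA. Qed.
Lemma rform_adj p q (X : 'M[C]_(p, q)) u v :
  rform (adjmx X) u v = rform X v u.
Proof.
by rewrite rform.unlock -[RHS]Re_conjC -adjmxE !adjmxM !adjmxK mulmxA.
Qed.
Lemma rformC p (X : 'M[C]_p) u v : is_hermitian X -> rform X u v = rform X v u.
Proof. by move=> hX; rewrite -rform_adj hX. Qed.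

Lemma rform_block p q r s (M1 : 'M[C]_(p, q)) (M2 : 'M[C]_(p, r))
    (M3 : 'M[C]_(s, q)) (M4 : 'M[C]_(s, r)) a b c d :
  rform (block_mx M1 M2 M3 M4) (col_mx a b) (col_mx c d) =
  rform M1 a c + rform M2 a d + rform M3 b c + rform M4 b d.
Proof.
rewrite rform.unlock adj_col_mx mul_row_block mul_row_col !mulmxDl !mxE !Re_add.
by rewrite addrACA !addrA.
Qed.
Lemma rform_col p q r (M1 : 'M[C]_(p, q)) (M2 : 'M[C]_(r, q)) a b c :
  rform (col_mx M1 M2) (col_mx a b) c = rform M1 a c + rform M2 b c.
Proof. by rewrite rform.unlock adj_col_mx mul_row_col mulmxDl mxE Re_add. Qed.
Lemma rform_row p q r (M1 : 'M[C]_(p, q)) (M2 : 'M[C]_(p, r)) a b c :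
  rform (row_mx M1 M2) a (col_mx b c) = rform M1 a b + rform M2 a c.
Proof. by rewrite rform.unlock mul_mx_row mul_row_col mxE Re_add. Qed.

(** The squared modulus, with values in [R] so that it can multiply [rform]. *)
Definition nsq (z : C) : R := Re z ^+ 2 + Im z ^+ 2.

Lemma rform_scale p q (X : 'M[C]_(p, q)) (c : C) u v :
  rform X (c *: u) (c *: v) = nsq c * rform X u v.
Proof.
rewrite rform.unlock adjmxZ -!scalemxAl -!scalemxAr !mxE mulrA Re_mul.
have -> : (c^* * c) = (nsq c)%:C%C.
  by apply: complex_eqP; rewrite ?Re_mul ?Im_mul Re_conjC Im_conjC /nsq /=; ring.
by rewrite /= mul0r subr0.
Qed.

(** The value equals its own conjugate. This is the bridge from the complex order in [psd] and [pd]
    to the order of [R]. *)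
Lemma hermitian_form_real p (X : 'M[C]_p) v : is_hermitian X ->
  (adjmx v *m X *m v) 0 0 = (rform X v v)%:C%C.
Proof.
move=> hX; apply: complex_eqP => /=; first by rewrite rform.unlock.
have : ((adjmx v *m X *m v) 0 0)^* = (adjmx v *m X *m v) 0 0.
  by rewrite -[LHS]adjmxE !adjmxM adjmxK hX mulmxA.
by move/(congr1 Im); rewrite Im_conjC; lra.
Qed.

Lemma psdP p (X : 'M[C]_p) :
  psd X <-> is_hermitian X /\ forall v, 0 <= rform X v v.
Proof.
split=> -[hX pX]; split=> // v; have := pX v.
  by rewrite hermitian_form_real // ler0c.
by rewrite hermitian_form_real // ler0c.
Qed.

Lemma pdP p (X : 'M[C]_p) :
  pd X <-> is_hermitian X /\ forall v, v != 0 -> 0 < rform X v v.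
Proof.
split=> -[hX pX]; split=> // v v0; have := pX v v0.
  by rewrite hermitian_form_real // ltcR.
by rewrite hermitian_form_real // ltcR.
Qed.

Lemma pd_psd p (X : 'M[C]_p) : pd X -> psd X.
Proof.
move=> /pdP[hX pX]; apply/psdP; split=> // v.
by have [->|/pX/ltW//] := eqVneq v 0; rewrite rform0l.
Qed.

Lemma hermD p (X Y : 'M[C]_p) :
  is_hermitian X -> is_hermitian Y -> is_hermitian (X + Y).
Proof. by rewrite /is_hermitian adjmxD => -> ->. Qed.
Lemma hermB p (X Y : 'M[C]_p) :
  is_hermitian X -> is_hermitian Y -> is_hermitian (X - Y).
Proof. by rewrite /is_hermitian adjmxB => -> ->. Qed.
Lemma hermZ p (c : R) (X : 'M[C]_p) :
  is_hermitian X -> is_hermitian (c%:C%C *: X).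
Proof. by rewrite /is_hermitian adjmxZr => ->. Qed.
Lemma herm1 p : is_hermitian (1%:M : 'M[C]_p).
Proof. exact: adjmx1. Qed.
Lemma herm_congr p q (X : 'M[C]_p) (A : 'M[C]_(p, q)) :
  is_hermitian X -> is_hermitian (adjmx A *m X *m A).
Proof. by move=> hX; rewrite /is_hermitian !adjmxM adjmxK hX mulmxA. Qed.
Lemma herm_addadj p (D : 'M[C]_p) : is_hermitian (adjmx D + D).
Proof. by rewrite /is_hermitian adjmxD adjmxK addrC. Qed.

(** Nonnegativity of the form on the real plane spanned by [u] and [v]. The form may be degenerate,
    so a null vector [v] is treated separately. *)
Lemma rform_CS p (X : 'M[C]_p) u v : psd X ->
  rform X u v ^+ 2 <= rform X u u * rform X v v.
Proof.
move=> /psdP[hX pX].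
set a := rform X u u; set b := rform X u v; set c := rform X v v.
have Q t s : 0 <= t ^+ 2 * a + 2 * t * s * b + s ^+ 2 * c.
  have := pX (t%:C%C *: u + s%:C%C *: v).
  rewrite !(rformDl, rformDr) !(rformZl, rformZr) (rformC v u) // -/a -/b -/c.
  by congr (0 <= _); ring.
have a0 : 0 <= a by exact: pX.
have c0 : 0 <= c by exact: pX.
have [c_eq0|cn0] := eqVneq c 0.
  have b0 : b = 0.
    apply/eqP/negP => /negP bn0.
    (* For [c = 0] the polynomial is affine in [s]; this [s] gives it the value [-1]. *)
    have := Q 1 (- (a + 1) / (2 * b)); rewrite c_eq0.
    have -> : 1 ^+ 2 * a + 2 * 1 * (- (a + 1) / (2 * b)) * b +
      (- (a + 1) / (2 * b)) ^+ 2 * 0 = -1 by field.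
    by rewrite oppr_ge0 ler10.
  by rewrite b0 c_eq0 expr0n /= mulr0.
have cp : 0 < c by rewrite lt_def cn0.
(* The minimiser [s / t = - b / c], with the denominator cleared. *)
have := Q c (- b).
have -> : c ^+ 2 * a + 2 * c * - b * b + (- b) ^+ 2 * c = c * (a * c - b ^+ 2).
  by ring.
by rewrite pmulr_rge0 // subr_ge0.
Qed.

Lemma rform_young p (X : 'M[C]_p) u v : psd X ->
  2 * rform X u v <= rform X u u + rform X v v.
Proof.
move=> /psdP[hX pX]; have := pX (u - v).
rewrite !(rformDl, rformDr, rformNl, rformNr) (rformC v u) //. lra.
Qed.

Definition sqn p (v : 'cV[C]_p) : R := rform 1%:M v v.

Lemma sqnE p (v : 'cV[C]_p) :
  sqn v = \sum_i (Re (v i 0) ^+ 2 + Im (v i 0) ^+ 2).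
Proof.
rewrite /sqn rform.unlock mulmx1 mxE Re_sum; apply: eq_bigr => i _.
by rewrite adjmxE; case: (v i 0) => a b; rewrite Re_mul Re_conjC Im_conjC /=; ring.
Qed.

Lemma sqn_ge0 p (v : 'cV[C]_p) : 0 <= sqn v.
Proof. by rewrite sqnE sumr_ge0 // => i _; rewrite addr_ge0 ?sqr_ge0. Qed.

Lemma sqn_eq0 p (v : 'cV[C]_p) : sqn v = 0 -> v = 0.
Proof.
rewrite sqnE => /psumr_eq0P h; apply/colP => i; rewrite mxE.
have /eqP := h (fun i _ => addr_ge0 (sqr_ge0 _) (sqr_ge0 _)) i isT.
rewrite paddr_eq0 ?sqr_ge0 // !sqrf_eq0 => /andP[/eqP a /eqP b].
exact: complex_eqP.
Qed.

Lemma pd1 p : pd (1%:M : 'M[C]_p).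
Proof.
apply/pdP; split=> [|v v0]; first exact: herm1.
rewrite lt_def sqn_ge0 andbT; apply: contra_neq v0; exact: sqn_eq0.
Qed.

Lemma sqn_gt0 p (v : 'cV[C]_p) : v != 0 -> 0 < sqn v.
Proof. by have /pdP[_] := pd1 p; apply. Qed.

Definition evec p (i : 'I_p) (c : C) : 'cV[C]_p := c *: delta_mx i 0.

Lemma adj_evec p (i : 'I_p) (c : C) (v : 'cV[C]_p) :
  (adjmx (evec i c) *m v) 0 0 = c^* * v i 0.
Proof.
rewrite mxE (bigD1 i) //= big1 => [|j ji]; rewrite !mxE.
  by rewrite !eqxx mulr1n mulr1 addr0.
by rewrite (negbTE ji) mulr0n mulr0 conjC0 mul0r.
Qed.

Lemma rform_evec p (i : 'I_p) (c : C) (v : 'cV[C]_p) :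
  rform 1%:M (evec i c) v = Re (c^* * v i 0).
Proof. by rewrite rform.unlock mulmx1 adj_evec. Qed.

(** Pairing with [e_i] and with [i e_i] gives the real coordinates of [v]; the norm estimates below
    bound each of them by Cauchy-Schwarz. *)
Lemma sqn_coords p (v : 'cV[C]_p) :
  sqn v = \sum_i (rform 1%:M (evec i 1) v ^+ 2 +
                  rform 1%:M (evec i 'i%C) v ^+ 2).
Proof.
rewrite sqnE; apply: eq_bigr => i _; rewrite !rform_evec.
by case: (v i 0) => a b; rewrite !Re_mul !Re_conjC !Im_conjC /=; ring.
Qed.

Lemma rform_le_sqn p q (X : 'M[C]_(q, p)) :
  exists K : R, forall v, sqn (X *m v) <= K * sqn v.
Proof.
pose F i := sqn (adjmx X *m evec i 1) + sqn (adjmx X *m evec i 'i%C).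
exists (\sum_i F i) => v; rewrite sqn_coords mulr_suml; apply: ler_sum => i _.
have E e : rform 1%:M e (X *m v) = rform 1%:M (adjmx X *m e) v.
  by rewrite -rform_mull -rform_mulr adjmxK mulmx1 mul1mx.
by rewrite /F mulrDl !E lerD // rform_CS //; exact/pd_psd/pd1.
Qed.

Lemma form_upper p (X : 'M[C]_p) :
  exists2 K : R, 0 < K & forall v, rform X v v <= K * sqn v.
Proof.
have [K hK] := rform_le_sqn X; exists (`|K| + 1) => [|v].
  by rewrite ltr_wpDl.
have := rform_young v (X *m v) (pd_psd (pd1 p)).
rewrite -/(sqn _) -/(sqn _) -rform_mulr mul1mx => h.
have := ler_wpM2r (sqn_ge0 v) (ler_norm K); have := hK v.
by have := mulr_ge0 (normr_ge0 K) (sqn_ge0 v); have := sqn_ge0 v; lra.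
Qed.

Lemma unitmx_colP p (P : 'M[C]_p) :
  (forall v : 'cV[C]_p, P *m v = 0 -> v = 0) -> P \in unitmx.
Proof.
move=> h; rewrite -unitmx_tr -row_free_unit -kermx_eq0.
apply/rowV0P => u /sub_kermxP uP; apply: trmx_inj; rewrite trmx0.
by apply: h; rewrite -[P]trmxK -trmx_mul uP trmx0.
Qed.

(** No compactness is used: a coordinate of [v] along [e] is the [P]-pairing of [v] with [P^-1 e],
    so Cauchy-Schwarz for [P] bounds its square by a constant times the form at [v]. *)
Lemma form_lower p (P : 'M[C]_p) : pd P ->
  exists2 c : R, 0 < c & forall v, c * sqn v <= rform P v v.
Proof.
move=> pP; have /pdP[hP posP] := pP.
have uP : P \in unitmx.
  apply: unitmx_colP => v Pv; apply/eqP; apply: contraT => v0.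
  by have := posP v v0; rewrite -[P]mul1mx rform_mulr Pv rform0r ltxx.
pose G e := rform P (invmx P *m e) (invmx P *m e).
have G0 e : 0 <= G e by have /psdP[_] := pd_psd pP; apply.
have E e v : rform 1%:M e v ^+ 2 <= G e * rform P v v.
  have -> : rform 1%:M e v = rform P (invmx P *m e) v.
    by rewrite -[e in LHS](mulKVmx uP) -rform_mull hP mulmx1.
  exact/rform_CS/pd_psd.
pose K := \sum_i (G (evec i 1) + G (evec i 'i%C)).
have K0 : 0 <= K by apply: sumr_ge0 => i _; rewrite addr_ge0.
exists (K + 1)^-1 => [|v]; first by rewrite invr_gt0 ltr_wpDl.
rewrite mulrC ler_pdivrMr ?ltr_wpDl // mulrC mulrDl mul1r.
have /psdP[_ /(_ v) v0] := pd_psd pP.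
apply: ler_wpDr => //; rewrite sqn_coords mulr_suml; apply: ler_sum => i _.
by rewrite mulrDl lerD.
Qed.

(** Openness of the positive definite cone along a ray: with [c] bounding [P] below and [K] bounding
    [Q] above, [d <= c / (2 K)] leaves at least half of [c]. *)
Lemma pd_sub p (P Q : 'M[C]_p) : pd P -> is_hermitian Q ->
  exists2 e : R, 0 < e & forall d, 0 <= d <= e -> pd (P - d%:C%C *: Q).
Proof.
move=> pP hQ; have [c c0 hc] := form_lower pP; have [K K0 hK] := form_upper Q.
exists (c / (2 * K)) => [|d /andP[d0 de]]; first by rewrite divr_gt0 // mulr_gt0.
have /pdP[hP _] := pP; apply/pdP; split=> [|v v0].
  by apply: hermB => //; apply: hermZ.
rewrite rformBm rformZm.
have := hc v; have := hK v; have := sqn_gt0 v0 => s0 k1 k2.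
have dK : d * (2 * K) <= c by rewrite -ler_pdivlMr // mulr_gt0.
nra.
Qed.

End Forms.

(** * Decomposition of positive semidefinite matrices *)

Section Rantzer.
Variable R : realType.
Local Notation C := (complex R).

Lemma adjmx_trC p q (M : 'M[C]_(p, q)) : adjmx M = map_mx Num.conj M^T.
Proof. by rewrite /adjmx map_trmx. Qed.

Lemma unitary_adj p q (U : 'M[C]_(p, q)) :
  (U \is unitarymx) <-> U *m adjmx U = 1%:M.
Proof. by rewrite adjmx_trC; split=> /unitarymxP. Qed.

Lemma unitary_adjV p q (U : 'M[C]_(p, q)) : p = q ->
  U \is unitarymx -> adjmx U *m U = 1%:M.
Proof.
by move=> pq hU; rewrite adjmx_trC -[X in X *m U]mul1mx mulmxKtV.
Qed.

Lemma gram_eq0 p q (N : 'M[C]_(p, q)) : N *m adjmx N = 0 -> N = 0.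
Proof.
move=> N0; apply/row_matrixP => i; rewrite row0.
have : sqn (adjmx (row i N)) = 0.
  rewrite /sqn rform.unlock adjmxK mulmx1.
  have -> : (row i N *m adjmx (row i N)) 0 0 = (N *m adjmx N) i i.
    by rewrite !mxE; apply: eq_bigr => k _; rewrite !mxE.
  by rewrite N0 mxE.
by move/sqn_eq0/(congr1 (@adjmx R _ _)); rewrite adjmxK adjmx0.
Qed.

(** Square roots of the eigenvalues in a unitary diagonalisation; each eigenvalue is nonnegative as
    the value of the form at an eigenvector. *)
Lemma psd_factor p (Z : 'M[C]_p) : psd Z -> exists G : 'M[C]_p, Z = G *m adjmx G.
Proof.
move=> /[dup] -[hZ pZ] _.
have /orthomx_spectralP : Z \is normalmx by apply/normalmxP; rewrite -adjmx_trC hZ.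
set P := spectralmx Z; set d := spectral_diag Z.
have uP : P \is unitarymx by exact: spectral_unitarymx.
rewrite invmx_unitary // -adjmx_trC => ZE.
have PP : P *m adjmx P = 1%:M by apply/unitary_adj.
have d0 i : 0 <= d 0 i.
  have := pZ (adjmx P *m evec i 1).
  rewrite adjmxM adjmxK ZE !mulmxA -(mulmxA _ P) PP mulmx1.
  rewrite -!(mulmxA _ P) PP mulmx1 -!mulmxA adj_evec conjC1 mul1r.
  by rewrite mul_diag_mx !mxE !eqxx mulr1n !mulr1.
pose s : 'rV[C]_p := \row_i sqrtC (d 0 i).
exists (adjmx P *m diag_mx s); rewrite adjmxM adjmxK.
rewrite mulmxA -[_ *m diag_mx s *m _]mulmxA {1}ZE; congr (_ *m _ *m _).
rewrite mul_diag_mx; apply/matrixP => i j; rewrite !mxE.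
rewrite (eq_sym j); have [->|] := eqVneq i j; last by rewrite conjC0 mulr0.
rewrite mulr1n conj_Creal ?ger0_real ?sqrtC_ge0 //.
by rewrite -expr2 sqrtCK.
Qed.

Lemma ortho_complement r p (E : 'M[C]_(r, p)) : E \is unitarymx ->
  exists Q : 'M[C]_(p - r, p), Q *m adjmx Q = 1%:M /\ E *m adjmx Q = 0.
Proof.
move=> uE; pose V := orthomx Num.conj (mx_of_hermitian (hermitian1mx p)) E.
have rV : \rank V = (p - r)%N by rewrite rank_ortho mxrank_unitary.
rewrite -rV; exists (schmidt (row_base V)); split.
  by apply/unitary_adj/schmidt_unitarymx/rank_leq_col.
apply/eqP; rewrite adjmx_trC -orthomx1E orthomx_sym.
by rewrite eqmx_schmidt_free ?row_base_free // eq_row_base.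
Qed.

(** Both orthonormal families of rows are completed to orthonormal bases, and [U] carries one basis
    to the other. *)
Lemma unitary_of_orthonormal r p (E1 E2 : 'M[C]_(r, p)) :
  E1 \is unitarymx -> E2 \is unitarymx ->
  exists2 U : 'M[C]_p, U \is unitarymx & E1 = E2 *m U.
Proof.
move=> u1 u2; have rp : (r <= p)%N by rewrite -(mxrank_unitary u1) rank_leq_col.
have [Q1 [QQ1 EQ1]] := ortho_complement u1.
have [Q2 [QQ2 EQ2]] := ortho_complement u2.
have EE1 : E1 *m adjmx E1 = 1%:M by apply/unitary_adj.
have EE2 : E2 *m adjmx E2 = 1%:M by apply/unitary_adj.
have QE1 : Q1 *m adjmx E1 = 0 by rewrite -[LHS]adjmxK adjmxM adjmxK EQ1 adjmx0.
have full : adjmx E2 *m E2 + adjmx Q2 *m Q2 = 1%:M.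
  rewrite -mul_row_col -adj_col_mx; apply: unitary_adjV; first by rewrite subnKC.
  apply/unitary_adj; rewrite adj_col_mx mul_col_row EE2 QQ2 EQ2.
  have -> : Q2 *m adjmx E2 = 0 by rewrite -[LHS]adjmxK adjmxM adjmxK EQ2 adjmx0.
  by rewrite -scalar_mx_block.
exists (adjmx E2 *m E1 + adjmx Q2 *m Q1).
  apply/unitary_adj; rewrite adjmxD !adjmxM !adjmxK mulmxDl !mulmxDr.
  rewrite !mulmxA -!(mulmxA _ _ (adjmx E1)) -!(mulmxA _ _ (adjmx Q1)).
  by rewrite EE1 QQ1 EQ1 QE1 !mulmx0 !mulmx1 !mul0mx addr0 add0r.
by rewrite mulmxDr !mulmxA EE2 EQ2 mul1mx mul0mx addr0.
Qed.

(** The row operations [K] that orthonormalise the rows of [F1] depend only on the Gram matrix, so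
    they orthonormalise those of [F2] as well; the two orthonormal families then differ by a
    unitary. *)
Lemma gram_eq_unitary n p (F1 F2 : 'M[C]_(n, p)) :
  F1 *m adjmx F1 = F2 *m adjmx F2 ->
  exists2 U : 'M[C]_p, U \is unitarymx & F1 = F2 *m U.
Proof.
move=> FF; pose E1 := schmidt (row_base F1).
have u1 : E1 \is unitarymx by apply/schmidt_unitarymx/rank_leq_col.
have EF : (E1 :=: F1)%MS.
  exact: eqmx_trans (eqmx_schmidt_free (row_base_free _)) (eq_row_base _).
have EE1 : E1 *m adjmx E1 = 1%:M by apply/unitary_adj.
have /submxP[D F1E] : (F1 <= E1)%MS by rewrite EF.
have /submxP[K E1E] : (E1 <= F1)%MS by rewrite EF.
have KD : K *m D = 1%:M.
  by rewrite -[K *m D]mulmx1 -EE1 mulmxA -[K *m D *m E1]mulmxA -F1E -E1E.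
pose E2 := K *m F2.
have u2 : E2 \is unitarymx.
  apply/unitary_adj; rewrite /E2 adjmxM mulmxA -(mulmxA K) -FF.
  by rewrite mulmxA -E1E -mulmxA -adjmxM -E1E.
have F2E : F2 = D *m E2.
  (* The Gram matrix of [(1 - D K) F2] is that of [(1 - D K) F1], which is zero. *)
  apply/eqP; rewrite -subr_eq0; apply/eqP; apply: gram_eq0.
  have -> : F2 - D *m E2 = (1%:M - D *m K) *m F2.
    by rewrite mulmxBl mul1mx mulmxA.
  rewrite adjmxM mulmxA -(mulmxA _ F2) -FF mulmxA.
  by rewrite mulmxBl mul1mx -(mulmxA D K) -E1E -F1E subrr !mul0mx.
have [U uU E12] := unitary_of_orthonormal u1 u2.
by exists U => //; rewrite {1}F1E E12 mulmxA -F2E.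
Qed.

(* The factor [G] of [Z] is determined up to a unitary on the right, which is
   chosen to diagonalise the unitary relating [S *m G] and [T *m G]. *)
Lemma psd_decomposition n p (S T : 'M[C]_(n, p)) (Z : 'M[C]_p) :
  psd Z -> S *m Z *m adjmx S = T *m Z *m adjmx T ->
  exists (G : 'M[C]_p) (l : 'rV[C]_p),
    [/\ Z = G *m adjmx G, T *m G = S *m G *m diag_mx l &
        forall j, `|l 0 j| = 1].
Proof.
move=> /psd_factor[G0 ->] h.
have [U uU TSU] : exists2 U : 'M[C]_p, U \is unitarymx &
    T *m G0 = S *m G0 *m U.
  by apply: gram_eq_unitary; rewrite !adjmxM !mulmxA -!(mulmxA _ G0) !mulmxA;
     rewrite !mulmxA in h; rewrite h.
have /unitary_adj UU := uU; have UV := unitary_adjV erefl uU.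
have /orthomx_spectralP : U \is normalmx.
  by apply/normalmxP; rewrite -adjmx_trC UU UV.
set P := spectralmx U; set d := spectral_diag U.
have uP : P \is unitarymx by exact: spectral_unitarymx.
have PP : P *m adjmx P = 1%:M by apply/unitary_adj.
have PV := unitary_adjV erefl uP.
rewrite invmx_unitary // -adjmx_trC => UE.
exists (G0 *m adjmx P), d; split.
- by rewrite adjmxM adjmxK mulmxA -(mulmxA G0) PV mulmx1.
- by rewrite mulmxA TSU UE !mulmxA -(mulmxA _ P) PP mulmx1.
(* The eigenvalues of a unitary matrix are unimodular. *)
- move=> j; have : diag_mx d *m adjmx (diag_mx d) = 1%:M.
    have -> : diag_mx d = P *m U *m adjmx P.
      by rewrite UE !mulmxA PP mul1mx -mulmxA PP mulmx1.
    by rewrite !adjmxM adjmxK !mulmxA -(mulmxA _ _ P) PV mulmx1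
               -(mulmxA _ U) UU mulmx1 PP.
  move/matrixP/(_ j j); rewrite mul_diag_mx !mxE eqxx !mulr1n => e.
  by apply/eqP; rewrite -sqrp_eq1 // normCK e.
Qed.

End Rantzer.

(** * Lyapunov inequality *)

Section Stability.
Variable R : realType.
Local Notation C := (complex R).
Local Notation Re := (@complex.Re R).
Local Notation Im := (@complex.Im R).

Lemma nsq_ge0 (z : C) : 0 <= nsq z.
Proof. by rewrite addr_ge0 ?sqr_ge0. Qed.

Lemma nsq_gt0 (z : C) : z != 0 -> 0 < nsq z.
Proof.
move=> z0; rewrite lt_def nsq_ge0 andbT; apply: contra_neq z0 => /eqP.
rewrite paddr_eq0 ?sqr_ge0 // !sqrf_eq0 => /andP[/eqP a /eqP b].
exact: complex_eqP.
Qed.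

Lemma norm_lt1 (z : C) : (`|z| < 1) = (nsq z < 1).
Proof. by rewrite normc_def -[1]/(1%:C%C) ltcR -{1}sqrtr1 ltr_sqrt. Qed.

Lemma norm_le1 (z : C) : (`|z| <= 1) = (nsq z <= 1).
Proof. by rewrite normc_def -[1]/(1%:C%C) lecR -{1}sqrtr1 ler_sqrt. Qed.

Lemma norm_eq1 (z : C) : `|z| = 1 <-> nsq z = 1.
Proof.
split=> h; apply/eqP; rewrite eq_le.
  rewrite -norm_le1 h lexx /= leNgt -norm_lt1 h ltxx //.
have := norm_lt1 z; rewrite h ltxx => n1.
by rewrite norm_le1 h lexx real_leNgt ?normr_real ?real1 // n1.
Qed.

Lemma resolvent_unit n (A : 'M[C]_n) z :
  (z%:M - A \in unitmx) = ~~ eigenvalue A z.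
Proof.
rewrite /eigenvalue /eigenspace negbK kermx_eq0 row_free_unit.
by rewrite -opprB -scaleN1r unitmxZ // unitrN1.
Qed.

(** [eigenvalue] is defined through row vectors; singularity of [l%:M - A] supplies a column
    eigenvector. *)
Lemma eigenvalue_colP n (A : 'M[C]_n) l : eigenvalue A l ->
  exists2 v : 'cV[C]_n, v != 0 & A *m v = l *: v.
Proof.
rewrite -[eigenvalue _ _]negbK -resolvent_unit => /negP nu.
apply: contrapT => h; apply: nu; apply: unitmx_colP => v.
rewrite mulmxBl mul_scalar_mx => /subr0_eq e.
by apply: contrapT => /eqP v0; apply: h; exists v.
Qed.

Lemma eigenvalueP_col n (A : 'M[C]_n) l (v : 'cV[C]_n) :
  v != 0 -> A *m v = l *: v ->
  eigenvalue A l.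
Proof.
move=> v0 Av; apply: contraT; rewrite -resolvent_unit => u.
move: v0; rewrite -(mulKmx u v) mulmxBl mul_scalar_mx Av subrr mulmx0 eqxx //.
Qed.

(** The strict Stein inequality, that is, [X - A^* X A] has positive form, with no sign assumed for
    [X]. *)
Definition decreasing n (A X : 'M[C]_n) : Prop :=
  forall v, v != 0 -> rform X (A *m v) (A *m v) < rform X v v.

(** As [A] is lower triangular, the vectors [(0, w)] form an invariant subspace, on which [X] is
    definite by induction. Let [e] span its [X]-orthogonal complement. Then [A e = a e + (0, w)] for
    some [w], and the decrease at [e] reads [(1 - |a|^2) X(e, e) > X2(w, w) >= 0], so
    [X(e, e) > 0]. *)
Lemma lyapunov_trig_step n (A X : 'M[C]_(1 + n)) :
  (forall X2 : 'M[C]_n, is_hermitian X2 -> decreasing (drsubmx A) X2 -> pd X2) ->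
  is_trig_mx A -> (forall i, nsq (A i i) < 1) -> is_hermitian X ->
  decreasing A X -> pd X.
Proof.
move=> IH tA dA hX dec.
have A12 : ursubmx A = 0.
  apply/matrixP => i j; rewrite !mxE; have /is_trig_mxP := tA; apply.
  by rewrite /= ord1.
set a := ulsubmx A; set A21 := dlsubmx A; set A2 := drsubmx A.
have AE : A = block_mx a 0 A21 A2 by rewrite -A12 submxK.
set x11 := ulsubmx X; set x12 := ursubmx X; set x21 := dlsubmx X.
set X2 := drsubmx X.
have XE : X = block_mx x11 x12 x21 X2 by rewrite submxK.
have [h12 h22] : adjmx x21 = x12 /\ adjmx X2 = X2.
  move: hX; rewrite /is_hermitian XE adj_block_mx => /eq_block_mx.
  by case=> _ ? _ ?.
have X0 (w : 'cV[C]_n) : rform X (col_mx 0 w) (col_mx 0 w) = rform X2 w w.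
  by rewrite XE rform_block !(rform0l, rform0r) !add0r.
have A0 (w : 'cV[C]_n) : A *m (col_mx 0 w : 'cV[C]_(1 + n)) = col_mx 0 (A2 *m w).
  by rewrite AE mul_block_col !mulmx0 mul0mx !add0r.
have pX2 : pd X2.
  apply: IH => // w w0.
  rewrite -!X0 -A0; apply: dec.
  by apply: contra_neq w0 => /(congr1 dsubmx); rewrite col_mxKd linear0.
have uX2 : X2 \in unitmx.
  apply: unitmx_colP => v Xv; apply/eqP; apply: contraT => v0.
  have /pdP[_ /(_ v v0)] := pX2.
  by rewrite -[X2]mul1mx rform_mulr Xv rform0r ltxx.
(* Block elimination: [e c] is the vector with first component [c] that is [X]-orthogonal to every
   [(0, w)]. *)
pose k := invmx X2 *m x21.
pose e (c : 'cV[C]_1) : 'cV[C]_(1 + n) := col_mx c (- (k *m c)).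
have orth c w : rform X (e c) (col_mx 0 w) = 0.
  have E12 : rform x12 c w = rform 1%:M (x21 *m c) w.
    by rewrite -h12 -[adjmx x21]mulmx1 rform_mull.
  have E22 : rform X2 (k *m c) w = rform 1%:M (x21 *m c) w.
    by rewrite -h22 -[adjmx X2]mulmx1 rform_mull /k !mulmxA mulmxV // mul1mx.
  by rewrite XE rform_block !rform0r addr0 add0r rformNl E12 E22 subrr.
have dcmp c (v2 : 'cV[C]_n) : col_mx c v2 = e c + col_mx 0 (v2 + k *m c).
  by rewrite add_col_mx addr0 addrC addrK.
have XD c w : rform X (e c + col_mx 0 w) (e c + col_mx 0 w) =
    nsq (c 0 0) * rform X (e 1%:M) (e 1%:M) + rform X2 w w.
  rewrite rformDl !rformDr orth (rformC _ _ hX) orth X0 addr0 add0r.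
  have -> : e c = c 0 0 *: e 1%:M.
    by rewrite /e scale_col_mx scalerN scalemxAr scalemx1 -mx11_scalar.
  by rewrite rform_scale.
have e1pos : 0 < rform X (e 1%:M) (e 1%:M).
  have := dec (e 1%:M) _; have -> : A *m e 1%:M =
      e a + col_mx 0 (A21 - A2 *m k + k *m a).
    by rewrite -dcmp /e {1}AE mul_block_col !mulmx1 mul0mx addr0 mulmxN.
  rewrite XD => /(_ _) h.
  have /psdP[_ /(_ (A21 - A2 *m k + k *m a)) p2] := pd_psd pX2.
  have n1 : nsq (a 0 0) < 1 by rewrite !mxE; exact: dA.
  have /h : e 1%:M != 0.
    apply/eqP => /(congr1 usubmx); rewrite col_mxKu linear0.
    by move/matrixP/(_ 0 0); rewrite !mxE => /eqP; rewrite oner_eq0.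
  by have := nsq_ge0 (a 0 0); nra.
apply/pdP; split=> // v; rewrite -[v]vsubmxK dcmp XD.
set c := usubmx v; set w : 'cV_n := dsubmx v + _ => v0.
have /psdP[_ /(_ w) p2] := pd_psd pX2.
have [c0|c0] := eqVneq (c 0 0) 0; last first.
  by rewrite ltr_pwDl // mulr_gt0 // nsq_gt0.
have cz : c = 0 by rewrite [c]mx11_scalar c0 raddf0.
rewrite cz mxE /nsq /= expr0n /= addr0 mul0r add0r.
have /pdP[_] := pX2; apply; apply: contra_neq v0 => ->.
by rewrite cz /e mulmx0 oppr0 col_mx0 addr0.
Qed.

Lemma lyapunov_trig n (A X : 'M[C]_n) : is_trig_mx A ->
  (forall i, nsq (A i i) < 1) -> is_hermitian X -> decreasing A X -> pd X.
Proof.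
elim: n A X => [|n IH] A X tA dA hX dec.
  by apply/pdP; split=> // v; rewrite flatmx0 eqxx.
apply: (@lyapunov_trig_step n A X) => // X2 hX2; apply: IH => // [|i].
  apply/is_trig_mxP => i j ij; rewrite !mxE.
  by have /is_trig_mxP := tA; apply; rewrite /= ltn_add2l.
by rewrite !mxE; exact: dA.
Qed.

(** A Schur triangularisation is unitary, so the decrease and definiteness of [X] transfer by
    congruence to the triangular case. No convergence of powers of [A] is involved. *)
Lemma lyapunov_pd n (A X : 'M[C]_n) :
  (forall l, eigenvalue A l -> `|l| < 1) -> is_hermitian X ->
  decreasing A X -> pd X.
Proof.
case: n A X => [|n] A X sA hX dec.
  by apply/pdP; split=> // v; rewrite flatmx0 eqxx.
have [P uP tP] := Schur A (ltn0Sn n).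
have PP : P *m adjmx P = 1%:M by apply/unitary_adj.
have PV : adjmx P *m P = 1%:M by apply: unitary_adjV.
move: tP; rewrite /similar_to/= conjymx // -adjmx_trC => tP.
pose Y := P *m X *m adjmx P.
have YE (v : 'cV[C]_n.+1) :
    rform Y v v = rform X (adjmx P *m v) (adjmx P *m v).
  by rewrite /Y -{1}[P]adjmxK rform_mulr rform_mull.
have AE : adjmx P *m (P *m A *m adjmx P) = A *m adjmx P.
  by rewrite !mulmxA PV mul1mx.
have pY : pd Y.
  apply: (lyapunov_trig tP) => [i||v v0].
  - rewrite -norm_lt1; apply: sA; set A' := P *m A *m adjmx P in tP *.
    have /eigenvalue_colP[v v0 Av] : eigenvalue A' (A' i i).
      rewrite eigenvalue_root_char char_poly_trig //.
      by rewrite -(big_map (fun i => A' i i) xpredT (fun a => 'X - a%:P))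
           root_prod_XsubC; apply/mapP; exists i; rewrite ?mem_index_enum.
    apply: (@eigenvalueP_col _ _ _ (adjmx P *m v)).
      by apply: contra_neq v0 => h; rewrite -[v]mul1mx -PP -mulmxA h mulmx0.
    by rewrite mulmxA -AE -mulmxA Av scalemxAr.
  - by rewrite /Y -{1}[P]adjmxK; apply: herm_congr.
  - rewrite !YE mulmxA AE -mulmxA; apply: dec.
    apply: contra_neq v0 => h; by rewrite -[v]mul1mx -PP -mulmxA h mulmx0.
apply/pdP; split=> // v v0.
have -> : v = adjmx P *m (P *m v) by rewrite mulmxA PV mul1mx.
rewrite -YE; have /pdP[_] := pY; apply; apply: contra_neq v0 => h.
by rewrite -[v]mul1mx -PV -mulmxA h mulmx0.
Qed.

End Stability.

Import numFieldNormedType.Exports.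
Local Open Scope classical_set_scope.

(** * Entrywise limits along an ultrafilter *)

Section Limits.
Variable R : realType.
Local Notation C := (complex R).
Local Notation Re := (@complex.Re R).
Local Notation Im := (@complex.Im R).
Variable U : set_system nat.
Context {UF : UltraFilter U}.

(** Stated by two real limits, so that only the topology of [R] enters. *)
Definition ccvg (z : nat -> C) (l : C) : Prop :=
  ((fun k => Re (z k)) @ U --> Re l) /\ ((fun k => Im (z k)) @ U --> Im l).

Lemma ccvg_cst c : ccvg (fun=> c) c.
Proof. by split; exact: cvg_cst. Qed.

Lemma ccvgD z w a b : ccvg z a -> ccvg w b -> ccvg (fun k => z k + w k) (a + b).
Proof.
move=> [za1 za2] [wb1 wb2]; split; rewrite ?Re_add ?Im_add.
  have -> : (fun k => Re (z k + w k)) = (fun k => Re (z k) + Re (w k)).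
    by apply/funext => k; rewrite Re_add.
  exact: cvgD.
have -> : (fun k => Im (z k + w k)) = (fun k => Im (z k) + Im (w k)).
  by apply/funext => k; rewrite Im_add.
exact: cvgD.
Qed.

Lemma ccvgM z w a b : ccvg z a -> ccvg w b -> ccvg (fun k => z k * w k) (a * b).
Proof.
move=> [za1 za2] [wb1 wb2]; split; rewrite ?Re_mul ?Im_mul.
  have -> : (fun k => Re (z k * w k)) =
      ((fun k => Re (z k)) \* (fun k => Re (w k))) \-
      ((fun k => Im (z k)) \* (fun k => Im (w k))).
    by apply/funext => k; rewrite Re_mul.
  exact: (cvgB (cvgM za1 wb1) (cvgM za2 wb2)).
have -> : (fun k => Im (z k * w k)) =
    ((fun k => Re (z k)) \* (fun k => Im (w k))) \+
    ((fun k => Im (z k)) \* (fun k => Re (w k))).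
  by apply/funext => k; rewrite Im_mul.
exact: (cvgD (cvgM za1 wb2) (cvgM za2 wb1)).
Qed.

Lemma ccvg_conj z a : ccvg z a -> ccvg (fun k => (z k)^*) (a^*).
Proof.
move=> [za1 za2]; split; rewrite ?Re_conjC ?Im_conjC.
  have -> : (fun k => Re ((z k)^*)) = (fun k => Re (z k)) => //.
  by apply/funext => k; rewrite Re_conjC.
have -> : (fun k => Im ((z k)^*)) = (fun k => - Im (z k)); last exact: cvgN.
by apply/funext => k; rewrite Im_conjC.
Qed.

Lemma ccvg_sum (I : Type) (r : seq I) (z : I -> nat -> C) (a : I -> C) :
  (forall i, ccvg (z i) (a i)) ->
  ccvg (fun k => \sum_(i <- r) z i k) (\sum_(i <- r) a i).
Proof.
move=> h; elim: r => [|i r IH].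
  by under eq_fun do rewrite big_nil; rewrite big_nil; exact: ccvg_cst.
by under eq_fun do rewrite big_cons; rewrite big_cons; exact: ccvgD.
Qed.

Lemma ccvg_unique z a b : ccvg z a -> ccvg z b -> a = b.
Proof.
move=> [a1 a2] [b1 b2]; apply: complex_eqP.
  exact: (cvg_unique _ a1 b1).
exact: (cvg_unique _ a2 b2).
Qed.

Definition mcvg p q (F : nat -> 'M[C]_(p, q)) (L : 'M[C]_(p, q)) : Prop :=
  forall i j, ccvg (fun k => F k i j) (L i j).

Lemma mcvg_cst p q (M : 'M[C]_(p, q)) : mcvg (fun=> M) M.
Proof. by move=> i j; exact: ccvg_cst. Qed.

Lemma mcvgD p q (F G : nat -> 'M[C]_(p, q)) K L : mcvg F K -> mcvg G L ->
  mcvg (fun k => F k + G k) (K + L).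
Proof.
by move=> a b i j; under eq_fun do rewrite mxE; rewrite mxE; exact: ccvgD.
Qed.

Lemma mcvgM p q r (F : nat -> 'M[C]_(p, q)) (G : nat -> 'M[C]_(q, r)) K L :
  mcvg F K -> mcvg G L -> mcvg (fun k => F k *m G k) (K *m L).
Proof.
move=> a b i j; under eq_fun do rewrite mxE; rewrite mxE.
by apply: ccvg_sum => l; exact: ccvgM.
Qed.

Lemma mcvgZ p q (c : nat -> C) (F : nat -> 'M[C]_(p, q)) d L : ccvg c d ->
  mcvg F L -> mcvg (fun k => c k *: F k) (d *: L).
Proof.
by move=> a b i j; under eq_fun do rewrite mxE; rewrite mxE; exact: ccvgM.
Qed.

Lemma mcvgB p q (F G : nat -> 'M[C]_(p, q)) K L : mcvg F K -> mcvg G L ->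
  mcvg (fun k => F k - G k) (K - L).
Proof.
move=> a b; rewrite -scaleN1r; under eq_fun do rewrite -scaleN1r.
by apply: mcvgD => //; apply: mcvgZ => //; exact: ccvg_cst.
Qed.

Lemma mcvg_adj p q (F : nat -> 'M[C]_(p, q)) L : mcvg F L ->
  mcvg (fun k => adjmx (F k)) (adjmx L).
Proof.
move=> a i j; under eq_fun do rewrite adjmxE; rewrite adjmxE; exact: ccvg_conj.
Qed.

Lemma mcvg_tr p (F : nat -> 'M[C]_p) L : mcvg F L ->
  ccvg (fun k => \tr (F k)) (\tr L).
Proof. by move=> a; apply: ccvg_sum. Qed.

Lemma mcvg_block p q r s F1 F2 F3 F4 L1 L2 L3 L4 :
  @mcvg p q F1 L1 -> @mcvg p r F2 L2 -> @mcvg s q F3 L3 -> @mcvg s r F4 L4 ->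
  mcvg (fun k => block_mx (F1 k) (F2 k) (F3 k) (F4 k)) (block_mx L1 L2 L3 L4).
Proof.
move=> a b c d i j; case: (split_ordP i) => i' ->; case: (split_ordP j) => j' ->.
- by under eq_fun do rewrite block_mxEul; rewrite block_mxEul; exact: a.
- by under eq_fun do rewrite block_mxEur; rewrite block_mxEur; exact: b.
- by under eq_fun do rewrite block_mxEdl; rewrite block_mxEdl; exact: c.
- by under eq_fun do rewrite block_mxEdr; rewrite block_mxEdr; exact: d.
Qed.

Lemma mcvg_col p q r F1 F2 L1 L2 :
  @mcvg p q F1 L1 -> @mcvg r q F2 L2 ->
  mcvg (fun k => col_mx (F1 k) (F2 k)) (col_mx L1 L2).
Proof.
move=> a b i j; case: (split_ordP i) => i' ->.
- by under eq_fun do rewrite col_mxEu; rewrite col_mxEu; exact: a.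
- by under eq_fun do rewrite col_mxEd; rewrite col_mxEd; exact: b.
Qed.

Lemma mcvg_row p q r F1 F2 L1 L2 :
  @mcvg p q F1 L1 -> @mcvg p r F2 L2 ->
  mcvg (fun k => row_mx (F1 k) (F2 k)) (row_mx L1 L2).
Proof.
move=> a b i j; case: (split_ordP j) => j' ->.
- by under eq_fun do rewrite row_mxEl; rewrite row_mxEl; exact: a.
- by under eq_fun do rewrite row_mxEr; rewrite row_mxEr; exact: b.
Qed.

Lemma mcvg_herm p (F : nat -> 'M[C]_p) L : mcvg F L ->
  (forall k, is_hermitian (F k)) -> is_hermitian L.
Proof.
move=> FL h; apply/matrixP => i j.
apply: ccvg_unique (mcvg_adj FL i j) _.
by under eq_fun do rewrite h; exact: FL.
Qed.

Lemma mcvg_rform p q (F : nat -> 'M[C]_(p, q)) L u v : mcvg F L ->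
  (fun k => rform (F k) u v) @ U --> rform L u v.
Proof.
move=> FL; rewrite rform.unlock.
have [h _] := mcvgM (mcvgM (mcvg_cst (adjmx u)) FL) (mcvg_cst v) 0 0.
exact: h.
Qed.

Lemma mcvg_psd p (F : nat -> 'M[C]_p) L : mcvg F L ->
  (forall k, psd (F k)) -> psd L.
Proof.
move=> FL h; apply/psdP; split; first by apply: mcvg_herm FL _ => k; case: (h k).
move=> v; have c : (fun k => rform (F k) v v) @ U --> rform L v v.
  exact: mcvg_rform.
rewrite -(cvg_lim _ c) //; apply: limr_ge.
  by apply/cvg_ex; exists (rform L v v).
by apply: nearW => k; have /psdP[_] := h k; apply.
Qed.

Lemma ultra_fmap (T : Type) (x : nat -> T) : UltraFilter (x @ U).
Proof.
split=> [|G PG sG]; first exact: fmap_proper_filter.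
rewrite eqEsubset; split=> // A GA.
have [//|UnA] := in_ultra_setVsetC (x @^-1` A) UF.
have /(filterI GA) : G (~` A) by exact: sG.
by rewrite setICr => /filter_not_empty.
Qed.

(** Bolzano-Weierstrass for ultrafilters: the image of [U] is an ultrafilter on the compact segment
    [[-K, K]]. The same [U] serves every bounded sequence. *)
Lemma real_bounded_ultra_cvg (x : nat -> R) (K : R) :
  (forall k, `|x k| <= K) -> exists l : R, x @ U --> l.
Proof.
move=> xK; have := @segment_compact R (- K) K; rewrite compact_ultra.
move=> /(_ (x @ U) (ultra_fmap x)) [|l [_ xl]]; last by exists l.
apply: (@filterS _ U _ setT); last exact: filterT.
by move=> k _; rewrite /= in_itv /= -ler_norml.
Qed.

Lemma bounded_mcvg p q (F : nat -> 'M[C]_(p, q)) (K : R) :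
  (forall k i j, `|Re (F k i j)| <= K) ->
  (forall k i j, `|Im (F k i j)| <= K) ->
  exists L, mcvg F L.
Proof.
move=> hR hI.
have [a ha] : {a : 'I_p -> 'I_q -> R &
    forall i j, (fun k => Re (F k i j)) @ U --> a i j}.
  have h i j : {l : R | (fun k => Re (F k i j)) @ U --> l}.
    by apply/cid/real_bounded_ultra_cvg => k; exact: hR.
  by exists (fun i j => sval (h i j)) => i j; exact: (svalP (h i j)).
have [b hb] : {a : 'I_p -> 'I_q -> R &
    forall i j, (fun k => Im (F k i j)) @ U --> a i j}.
  have h i j : {l : R | (fun k => Im (F k i j)) @ U --> l}.
    by apply/cid/real_bounded_ultra_cvg => k; exact: hI.
  by exists (fun i j => sval (h i j)) => i j; exact: (svalP (h i j)).
exists (\matrix_(i, j) Complex (a i j) (b i j)) => i j; rewrite mxE.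
by split; [exact: ha|exact: hb].
Qed.

End Limits.

(** * Duality for linear matrix inequalities *)

Section LMI.
Variable R : realType.
Local Notation C := (complex R).
Local Notation Re := (@complex.Re R).
Local Notation Im := (@complex.Im R).

(** Refining [\oo] makes ordinary limits of sequences limits along [U]. *)
Lemma ultrafilter_nat : exists U : set_system nat, UltraFilter U /\ \oo `<=` U.
Proof. by apply: ultraFilterLemma. Qed.

Definition unit_trace_psd p (Z : 'M[C]_p) : Prop := psd Z /\ \tr Z = 1.

Lemma Re_form_evec p (Z : 'M[C]_p) i j : Re (Z i j) = rform Z (evec i 1) (evec j 1).
Proof.
rewrite rform.unlock -mulmxA adj_evec conjC1 mul1r mxE (bigD1 j) //= big1 => [|k kj].
  by rewrite !mxE !eqxx mulr1n !mulr1 addr0.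
by rewrite !mxE (negbTE kj) mulr0n !mulr0.
Qed.

Lemma Im_form_evec p (Z : 'M[C]_p) i j :
  Im (Z i j) = rform Z (evec i 'i%C) (evec j 1).
Proof.
rewrite rform.unlock -mulmxA adj_evec mxE (bigD1 j) //= big1 => [|k kj].
  by rewrite !mxE !eqxx mulr1n !mulr1 addr0 Re_mul Re_conjC Im_conjC /=; ring.
by rewrite !mxE (negbTE kj) mulr0n !mulr0.
Qed.

Lemma rform_evec_i p (Z : 'M[C]_p) i :
  rform Z (evec i 'i%C) (evec i 'i%C) = Re (Z i i).
Proof.
rewrite Re_form_evec.
have -> : evec i 'i%C = 'i%C *: evec i 1 :> 'cV[C]_p by rewrite /evec scalerA mulr1.
by rewrite rform_scale /nsq /= expr0n expr1n add0r mul1r.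
Qed.

(** Cauchy-Schwarz on basis vectors bounds the squared real and imaginary parts of [Z_ij] by
    [Z_ii Z_jj], so control of the diagonal is enough. *)
Lemma psd_entries_bounded p (Z : 'M[C]_p) (K : R) : psd Z ->
  (forall i, Re (Z i i) <= K) ->
  forall i j, `|Re (Z i j)| <= K /\ `|Im (Z i j)| <= K.
Proof.
move=> pZ hK i j; have /psdP[_ p0] := pZ.
have d0 k : 0 <= Re (Z k k) by rewrite Re_form_evec.
have K0 : 0 <= K := le_trans (d0 i) (hK i).
have sq x : x ^+ 2 <= Re (Z i i) * Re (Z j j) -> `|x| <= K.
  move=> h; rewrite -(ler_pXn2r (ltn0Sn 1)) ?nnegrE // real_normK ?num_real //.
  by apply: le_trans h _; rewrite expr2 ler_pM.
split; apply: sq.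
  by rewrite !Re_form_evec rform_CS.
by rewrite Im_form_evec -(rform_evec_i Z i) (Re_form_evec Z j) rform_CS.
Qed.

Lemma unit_trace_diag_le1 p (Z : 'M[C]_p) i : unit_trace_psd Z -> Re (Z i i) <= 1.
Proof.
move=> [/psdP[_ p0] /(congr1 Re)]; rewrite /mxtrace Re_sum /= => <-.
rewrite (bigD1 i) //= lerDl sumr_ge0 // => j _.
by rewrite Re_form_evec.
Qed.

Lemma outer_psd p (g : 'cV[C]_p) : psd (g *m adjmx g).
Proof.
split=> [|v]; first by rewrite /is_hermitian adjmxM adjmxK.
rewrite mulmxA -mulmxA -{1}[g]adjmxK -adjmxM mxE big_ord1 adjmxE.
by rewrite mulrC mul_conjC_ge0.
Qed.

Lemma psdD p (X Y : 'M[C]_p) : psd X -> psd Y -> psd (X + Y).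
Proof.
move=> /psdP[hX pX] /psdP[hY pY]; apply/psdP; split=> [|v]; first exact: hermD.
by rewrite rformDm addr_ge0.
Qed.

Lemma psdZ p (c : R) (X : 'M[C]_p) : 0 <= c -> psd X -> psd (c%:C%C *: X).
Proof.
move=> c0 /psdP[hX pX]; apply/psdP; split=> [|v]; first exact: hermZ.
by rewrite rformZm mulr_ge0.
Qed.

(** A minimising sequence has bounded entries, hence a limit along [U], and the slice is closed.
    [0 <= J] makes the infimum finite and [0 < p] makes the slice nonempty. *)
Lemma unit_trace_psd_min p (J : 'M[C]_p -> R) : (0 < p)%N ->
  (forall U : set_system nat, UltraFilter U -> forall F L, mcvg U F L ->
    (fun k => J (F k)) @ U --> J L) ->
  (forall Z, 0 <= J Z) ->
  exists2 Z0, unit_trace_psd Z0 & forall Z, unit_trace_psd Z -> J Z0 <= J Z.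
Proof.
move=> p0 cJ J0; pose S := [set J Z | Z in @unit_trace_psd p].
have S0 : S !=set0.
  pose g := evec (Ordinal p0) 1 : 'cV[C]_p.
  exists (J (g *m adjmx g)), (g *m adjmx g) => //; split; first exact: outer_psd.
  rewrite mxtrace_mulC trace_mx11 adj_evec conjC1 mul1r !mxE !eqxx /=.
  by rewrite mulr1n mulr1.
have infS : has_inf S by split=> //; exists 0 => _ [Z _ <-].
have [F hF] : {F : nat -> 'M[C]_p & forall k,
    unit_trace_psd (F k) /\ J (F k) < inf S + k.+1%:R^-1}.
  have h k : {Z | unit_trace_psd Z /\ J Z < inf S + k.+1%:R^-1}.
    apply: cid; have [|_ [Z KZ <-] hZ] := inf_adherent (eps := k.+1%:R^-1) _ infS.
      by rewrite invr_gt0.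
    by exists Z.
  by exists (fun k => sval (h k)) => k; exact: (svalP (h k)).
have [U [UU ooU]] := ultrafilter_nat.
have bd k i j : `|Re (F k i j)| <= 1 /\ `|Im (F k i j)| <= 1.
  have [KF _] := hF k; apply: psd_entries_bounded => [|l]; first by case: KF.
  exact: unit_trace_diag_le1.
have [L FL] := @bounded_mcvg R U UU _ _ F 1 (fun k i j => (bd k i j).1)
  (fun k i j => (bd k i j).2).
exists L.
  split; first by apply: mcvg_psd FL _ => k; have [[]] := hF k.
  apply: ccvg_unique (mcvg_tr FL) _.
  under eq_fun do rewrite (hF _).1.2; exact: ccvg_cst.
move=> Z KZ; have SJ : inf S <= J Z by apply: ge_inf; [case: infS|exists Z].
apply: le_trans SJ.
have c1 : (fun k => inf S + k.+1%:R^-1) @ U --> inf S + 0.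
  apply: cvgD; first exact: cvg_cst.
  move=> V hV; apply: ooU; exact: cvg_harmonic hV.
rewrite addr0 in c1.
have c2 := cJ U UU F L FL.
rewrite -(cvg_lim _ c1) // -(cvg_lim _ c2) //; apply: ler_lim.
- by apply/cvg_ex; exists (J L).
- by apply/cvg_ex; exists (inf S).
- by apply: nearW => k; apply/ltW; case: (hF k).
Qed.

(** The Frobenius inner product on Hermitian matrices. It contains no adjoint, so [ip X X >= 0] is
    available for Hermitian [X]. *)
Definition ip p q (X : 'M[C]_(p, q)) (Y : 'M[C]_(q, p)) : R := Re (\tr (X *m Y)).

Lemma ipDl p q (X1 X2 : 'M[C]_(p, q)) Y : ip (X1 + X2) Y = ip X1 Y + ip X2 Y.
Proof. by rewrite /ip mulmxDl mxtraceD Re_add. Qed.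
Lemma ipDr p q (X : 'M[C]_(p, q)) Y1 Y2 : ip X (Y1 + Y2) = ip X Y1 + ip X Y2.
Proof. by rewrite /ip mulmxDr mxtraceD Re_add. Qed.
Lemma ipZl p q (c : R) (X : 'M[C]_(p, q)) Y : ip (c%:C%C *: X) Y = c * ip X Y.
Proof. by rewrite /ip -scalemxAl mxtraceZ Re_mul /= mul0r subr0. Qed.
Lemma ipZr p q (c : R) (X : 'M[C]_(p, q)) Y : ip X (c%:C%C *: Y) = c * ip X Y.
Proof. by rewrite /ip -scalemxAr mxtraceZ Re_mul /= mul0r subr0. Qed.
Lemma ipBr p q (X : 'M[C]_(p, q)) Y1 Y2 : ip X (Y1 - Y2) = ip X Y1 - ip X Y2.
Proof. by rewrite ipDr -scaleN1r -(rmorphN1 (real_complex R)) ipZr mulN1r. Qed.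
Lemma ipC p q (X : 'M[C]_(p, q)) Y : ip X Y = ip Y X.
Proof. by rewrite /ip mxtrace_mulC. Qed.

Lemma ip_expand p (X Y : 'M[C]_p) t :
  ip (X + t%:C%C *: Y) (X + t%:C%C *: Y) =
  ip X X + 2 * t * ip X Y + t ^+ 2 * ip Y Y.
Proof. by rewrite !(ipDl, ipDr) !(ipZl, ipZr) (ipC Y X); ring. Qed.

Lemma ip_outer p q (X : 'M[C]_p) (S : 'M[C]_(p, q)) (g : 'cV[C]_q) :
  ip X (S *m (g *m adjmx g) *m adjmx S) = rform X (S *m g) (S *m g).
Proof.
have -> : S *m (g *m adjmx g) *m adjmx S = S *m g *m adjmx (S *m g).
  by rewrite adjmxM !mulmxA.
move: (S *m g) => w.
by rewrite /ip rform.unlock mulmxA mxtrace_mulC trace_mx11 mulmxA.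
Qed.

Lemma ip_herm_ge0 p (X : 'M[C]_p) : is_hermitian X -> 0 <= ip X X.
Proof.
move=> hX; rewrite /ip -{2}hX /mxtrace Re_sum sumr_ge0 // => i _.
rewrite mxE Re_sum sumr_ge0 // => j _; rewrite adjmxE Re_mul Re_conjC Im_conjC.
by rewrite mulrN opprK addr_ge0 // -expr2 sqr_ge0.
Qed.

Lemma ip_herm_eq0 p (X : 'M[C]_p) : is_hermitian X -> ip X X = 0 -> X = 0.
Proof.
move=> hX; rewrite /ip -{2}hX /mxtrace Re_sum => h0.
apply/matrixP => i j; rewrite mxE.
have e k l : Re (X k l * adjmx X l k) = nsq (X k l).
  by rewrite adjmxE Re_mul Re_conjC Im_conjC mulrN opprK -!expr2.
have h i' : Re ((X *m adjmx X) i' i') = \sum_l nsq (X i' l).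
  by rewrite mxE Re_sum; apply: eq_bigr => l _; rewrite e.
rewrite (eq_bigr _ (fun i' _ => h i')) in h0.
have /psumr_eq0P : \sum_l nsq (X i l) = 0.
  apply: (psumr_eq0P _ h0) => // k _; apply: sumr_ge0 => l _; exact: nsq_ge0.
move=> /(_ (fun l _ => nsq_ge0 _)) /(_ j isT) n0.
by apply/eqP; apply: contraT => /nsq_gt0; rewrite n0 ltxx.
Qed.

(** The maximum of [x] and [0], written with the absolute value so that continuity follows from that
    of the norm. *)
Definition pospart (x : R) : R := (`|x| + x) / 2.

Lemma pospart_ge0 x : 0 <= pospart x.
Proof. by rewrite divr_ge0 // -lerBlDr sub0r ler_normr lexx orbT. Qed.
Lemma pospart_ge x : x <= pospart x.
Proof. by rewrite ler_pdivlMr // mulr_natr mulr2n lerD2r ler_norm. Qed.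
(** The square of the positive part is the least value of [(x + y) ^+ 2] over slacks [y >= 0]. *)
Lemma pospart_sqr x y : 0 <= y -> pospart x ^+ 2 <= (x + y) ^+ 2.
Proof.
move=> y0; rewrite /pospart; have [x0|x0] := ger0P x.
  by have -> : (x + x) / 2 = x; [field|nra].
by rewrite addNr mul0r expr0n /= sqr_ge0.
Qed.

(* Finite-dimensional separation: the point of least norm of the convex set
   [{(S Z S^* - T Z T^* , <W, Z> + s) | s >= 0}] gives the multipliers. *)
Lemma lmi_alternative n p (S T : 'M[C]_(n, p)) (W : 'M[C]_p) : (0 < p)%N ->
  (forall Z, psd Z -> Z != 0 -> S *m Z *m adjmx S = T *m Z *m adjmx T ->
     0 < ip W Z) ->
  exists (X : 'M[C]_n) (tau : R), [/\ is_hermitian X, 0 <= tau &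
    forall g, g != 0 ->
      0 < rform X (S *m g) (S *m g) - rform X (T *m g) (T *m g) + tau * rform W g g].
Proof.
move=> p0 hW.
pose Phi (Z : 'M[C]_p) : 'M[C]_n := S *m Z *m adjmx S - T *m Z *m adjmx T.
have PhiD Z1 Z2 : Phi (Z1 + Z2) = Phi Z1 + Phi Z2.
  by rewrite /Phi !mulmxDr !mulmxDl opprD addrACA.
have PhiZ (c : R) Z : Phi (c%:C%C *: Z) = c%:C%C *: Phi Z.
  by rewrite /Phi -!scalemxAr -!scalemxAl scalerBr.
have hPhi Z : is_hermitian Z -> is_hermitian (Phi Z).
  by move=> hZ; apply: hermB; rewrite /is_hermitian !adjmxM adjmxK hZ mulmxA.
(* The squared norm after minimisation over the slack. The adjoint keeps [J] nonnegative for every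
   [Z]; it disappears on Hermitian [Z]. *)
pose J Z := ip (Phi Z) (adjmx (Phi Z)) + pospart (ip W Z) ^+ 2.
have JE Z : is_hermitian Z -> J Z = ip (Phi Z) (Phi Z) + pospart (ip W Z) ^+ 2.
  by move=> hZ; rewrite /J hPhi.
have J0 Z : 0 <= J Z.
  rewrite addr_ge0 ?sqr_ge0 // /ip /mxtrace Re_sum sumr_ge0 // => i _.
  rewrite mxE Re_sum sumr_ge0 // => j _; rewrite adjmxE Re_mul Re_conjC Im_conjC.
  by rewrite mulrN opprK addr_ge0 // -expr2 sqr_ge0.
have cJ (U : set_system nat) : UltraFilter U -> forall F L, mcvg U F L ->
    (fun k => J (F k)) @ U --> J L.
  move=> UU F L FL.
  have FP : mcvg U (fun k => Phi (F k)) (Phi L).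
    by apply: mcvgB; apply: mcvgM; try exact: mcvg_cst;
       apply: mcvgM FL; exact: mcvg_cst.
  have [c1 _] := mcvg_tr (mcvgM FP (mcvg_adj FP)).
  have [c2 _] := mcvg_tr (mcvgM (mcvg_cst (U := U) W) FL).
  apply: cvgD; first exact: c1.
  have c3 : (fun k => pospart (ip W (F k))) @ U --> pospart (ip W L).
    by apply: cvgMl; apply: cvgD; [exact: cvg_norm c2|exact: c2].
  have -> : (fun k => pospart (ip W (F k)) ^+ 2) =
      (fun k => pospart (ip W (F k))) \* (fun k => pospart (ip W (F k))).
    by apply/funext => k; rewrite expr2.
  by rewrite expr2; exact: (cvgM c3 c3).
have [Z0 KZ0 minZ0] := unit_trace_psd_min p0 cJ J0.
have [pZ0 tZ0] := KZ0; have [hZ0 _] := pZ0.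
set X0 := Phi Z0; set h0 := ip W Z0; set tau := pospart h0.
have hX0 : is_hermitian X0 by exact: hPhi.
pose delta := ip X0 X0 + tau ^+ 2.
(* A zero minimum would give a nonzero [Z0] with [S Z0 S^* = T Z0 T^*] and [ip W Z0 <= 0], against
   the hypothesis. *)
have delta0 : 0 < delta.
  have d0 : 0 <= delta by rewrite addr_ge0 ?sqr_ge0 ?ip_herm_ge0.
  rewrite lt_def d0 andbT; apply/eqP => /eqP.
  rewrite paddr_eq0 ?sqr_ge0 ?ip_herm_ge0 // sqrf_eq0 => /andP[/eqP x0 /eqP t0].
  have /(hW _ pZ0) : Z0 != 0.
    by apply: contra_eq_neq tZ0 => ->; rewrite mxtrace0 eq_sym oner_eq0.
  have /eqP := ip_herm_eq0 hX0 x0; rewrite subr_eq0 => /eqP e /(_ e).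
  by rewrite -/h0 ltNge; have := pospart_ge h0; rewrite -/tau t0 => ->.
(* First-order optimality of [Z0]: [2 a] is the slope along the segment towards [Z], with the slack
   moved along as well. *)
have key Z : unit_trace_psd Z -> delta <= ip X0 (Phi Z) + tau * ip W Z.
  move=> [pZ tZ]; have [hZ _] := pZ.
  pose Dl : 'M[C]_n := Phi Z - X0; pose a := ip X0 Dl + tau * (ip W Z - tau).
  pose b := ip Dl Dl + (ip W Z - tau) ^+ 2.
  have hD : is_hermitian Dl by exact: (hermB (hPhi _ hZ) hX0).
  have b0 : 0 <= b by rewrite addr_ge0 ?sqr_ge0 ?ip_herm_ge0.
  have step t : 0 < t <= 1 -> 0 <= 2 * a + t * b.
    move=> /andP[t0 t1].
    pose Zt := (1 - t)%:C%C *: Z0 + t%:C%C *: Z.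
    have pZt : psd Zt by apply: psdD; apply: psdZ; rewrite ?subr_ge0 // ltW.
    have KZt : unit_trace_psd Zt.
      split=> //; rewrite mxtraceD !mxtraceZ tZ tZ0 !mulr1.
      by rewrite -rmorphD /= subrK.
    have [hZt _] := pZt.
    have := minZ0 _ KZt; rewrite !JE // -/X0 -/h0 -/tau.
    have -> : Phi Zt = X0 + t%:C%C *: Dl.
      rewrite PhiD !PhiZ /Dl /X0; move: (Phi Z) (Phi Z0) => P Q.
      by rewrite rmorphB rmorph1 scalerBl scale1r scalerBr -addrA (addrC (- _)).
    have -> : ip W Zt = h0 + t * (ip W Z - h0).
      by rewrite ipDr !ipZr -/h0; ring.
    rewrite ip_expand.
    (* With this slack the second coordinate becomes [tau + t (ip W Z - tau)], affine in [t]. *)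
    have s0 : 0 <= (1 - t) * (tau - h0).
      by rewrite mulr_ge0 // subr_ge0 // pospart_ge.
    have := pospart_sqr (h0 + t * (ip W Z - h0)) s0.
    move: (pospart _) => q qle hle.
    rewrite -(pmulr_rge0 _ t0) /a /b.
    by move: (ip X0 X0) (ip X0 Dl) (ip Dl Dl) hle => xx xd dd hle; nra.
  have a0 : 0 <= a.
    rewrite leNgt; apply/negP => an.
    have bn : 0 < b - a by rewrite subr_gt0 (lt_le_trans an).
    (* If [a < 0], this [t] lies in [(0, 1]] and satisfies [t b <= - a], hence
       [2 a + t b <= a < 0]. *)
    have := step (- a / (b - a)); rewrite divr_gt0 ?oppr_gt0 //.
    rewrite ler_pdivrMr // mul1r lerDr b0 => /(_ isT).
    rewrite leNgt => /negP; apply.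
    have : - a / (b - a) * b <= - a.
      rewrite mulrAC ler_pdivrMr // ler_pM2l ?oppr_gt0 //; lra.
    by lra.
  move: a0; rewrite /a /delta /Dl (ipBr X0 (Phi Z) X0).
  by move: (ip X0 X0) (ip X0 (Phi Z)) (ip W Z) (tau) => xx xp wz t; lra.
exists X0, tau; split=> //; first exact: pospart_ge0.
move=> g g0; have s0 := sqn_gt0 g0.
pose Z := (sqn g)^-1%:C%C *: (g *m adjmx g).
have KZ : unit_trace_psd Z.
  split; first by apply: psdZ (outer_psd g); rewrite invr_ge0 ltW.
  rewrite mxtraceZ mxtrace_mulC trace_mx11 -[adjmx g]mulmx1.
  rewrite hermitian_form_real; last exact: herm1.
  by rewrite -/(sqn g) -rmorphM /= mulVf // gt_eqF.
have := lt_le_trans delta0 (key Z KZ).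
rewrite PhiZ !ipZr ipBr !ip_outer.
have -> : ip W (g *m adjmx g) = rform W g g.
  by have := ip_outer W 1%:M g; rewrite adjmx1 !mul1mx mulmx1.
by rewrite mulrCA -mulrDr pmulr_rgt0 // invr_gt0.
Qed.

End LMI.

(** * The Kalman-Yakubovich-Popov lemma *)

Section KYP.
Variable R : realType.
Local Notation C := (complex R).
Local Notation Re := (@complex.Re R).
Local Notation Im := (@complex.Im R).

Lemma Wmx_herm n m (X : 'M[C]_n) (N : model R n m) :
  is_hermitian X -> is_hermitian (Wmx X N).
Proof.
move=> hX; rewrite /is_hermitian /Wmx adj_block_mx; congr block_mx.
- by rewrite adjmxB !adjmxM adjmxK hX mulmxA.
- by rewrite adjmxB !adjmxM adjmxK hX mulmxA.
- by rewrite adjmxB !adjmxM !adjmxK hX mulmxA.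
- by rewrite adjmxB !adjmxM adjmxK hX mulmxA herm_addadj.
Qed.

Lemma Wtmx_herm n m (X : 'M[C]_n) (N : model R n m) :
  is_hermitian X -> is_hermitian (Wtmx X N).
Proof.
move=> hX; rewrite /is_hermitian /Wtmx !adj_block_mx adj_col_mx adj_row_mx.
by rewrite !adjmxM !adjmxK hX herm_addadj.
Qed.

Lemma diagXX2_herm n m (X : 'M[C]_n) :
  is_hermitian X -> is_hermitian (diagXX2 m X).
Proof.
move=> hX; rewrite /is_hermitian /diagXX2 !adj_block_mx hX !adjmx0.
by rewrite -(rmorph_nat (real_complex R)) adjmx_scalar_real.
Qed.

(** The dissipation balance: with next state [A x + B u] and output [y = C x + D u], the value is
    the loss of storage [X] plus the supply [2 Re (u^* y)]. *)
Lemma Wmx_form n m (X : 'M[C]_n) (N : model R n m) x u : is_hermitian X ->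
  rform (Wmx X N) (col_mx x u) (col_mx x u) =
  rform X x x - rform X (mA N *m x + mB N *m u) (mA N *m x + mB N *m u) +
  (2 * rform (mC N) u x + rform (adjmx (mD N) + mD N) u u).
Proof.
move=> hX; rewrite /Wmx rform_block !rformBm -!mulmxA !rform_mull !rform_mulr.
rewrite rform_adj rformDl !rformDr (rformC (mB N *m u) (mA N *m x) hX); ring.
Qed.

(** The Schur complement as a completed square. As an identity it needs no inverse of [X], so it
    also covers singular [X]. *)
Lemma Wtmx_form n m (X : 'M[C]_n) (N : model R n m) a x u : is_hermitian X ->
  rform (Wtmx X N) (col_mx (col_mx a x) u) (col_mx (col_mx a x) u) =
  rform X (a + (mA N *m x + mB N *m u)) (a + (mA N *m x + mB N *m u)) +
  rform (Wmx X N) (col_mx x u) (col_mx x u).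
Proof.
move=> hX; rewrite Wmx_form // /Wtmx !rform_block rform_col rform_row.
rewrite !rform_mull !rform_mulr rform_adj.
set y := mA N *m x; set z := mB N *m u.
have -> : a + (y + z) = a + y + z by rewrite addrA.
rewrite !rformDl !rformDr (rformC y a hX) (rformC z a hX) (rformC z y hX); ring.
Qed.

Lemma diag_form n m (X : 'M[C]_n) (a x : 'cV[C]_n) (u : 'cV[C]_m) :
  rform (diagXX2 m X) (col_mx (col_mx a x) u) (col_mx (col_mx a x) u) =
  rform X a a + rform X x x + 2 * sqn u.
Proof.
rewrite /diagXX2 !rform_block !rform0m !addr0 -scalemx1.
by rewrite -(rmorph_nat (real_complex R)) rformZm /sqn.
Qed.

Lemma Wtmx_psd n m (X : 'M[C]_n) (N : model R n m) :
  psd (Wtmx X N) -> is_hermitian X -> psd X /\ psd (Wmx X N).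
Proof.
move=> /psdP[_ pW] hX; split; apply/psdP; split=> //; last 2 first.
- exact: Wmx_herm.
- move=> v; rewrite -[v]vsubmxK; set x := usubmx v; set u := dsubmx v.
  (* This first component annihilates the square. *)
  have := pW (col_mx (col_mx (- (mA N *m x + mB N *m u)) x) u).
  by rewrite Wtmx_form // addNr rform0l add0r.
move=> v; have := pW (col_mx (col_mx v 0) 0).
by rewrite Wtmx_form // col_mx0 rform0l !mulmx0 !addr0.
Qed.

Lemma Wtmx_pd n m (X : 'M[C]_n) (N : model R n m) :
  pd (Wtmx X N) -> is_hermitian X -> pd X /\ pd (Wmx X N).
Proof.
move=> /pdP[_ pW] hX; split; apply/pdP; split=> //; last 2 first.
- exact: Wmx_herm.
- move=> v; rewrite -[v]vsubmxK; set x := usubmx v; set u := dsubmx v => v0.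
  have := pW (col_mx (col_mx (- (mA N *m x + mB N *m u)) x) u).
  rewrite Wtmx_form // addNr rform0l add0r; apply.
  by apply: contra_neq v0; rewrite -!col_mx0 => /eq_col_mx[/eq_col_mx[_ ->] ->].
move=> v v0; have := pW (col_mx (col_mx v 0) 0).
rewrite Wtmx_form // col_mx0 rform0l !mulmx0 !addr0; apply.
by apply: contra_neq v0; rewrite -!col_mx0 => /eq_col_mx[/eq_col_mx[-> _] _].
Qed.

Lemma psd_Wtmx n m (X : 'M[C]_n) (N : model R n m) :
  psd X -> psd (Wmx X N) -> psd (Wtmx X N).
Proof.
move=> /psdP[hX pX] /psdP[_ pW]; apply/psdP; split; first exact: Wtmx_herm.
move=> v; rewrite -[v]vsubmxK -[usubmx v]vsubmxK Wtmx_form //.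
exact: addr_ge0.
Qed.

Lemma pd_Wtmx n m (X : 'M[C]_n) (N : model R n m) :
  pd X -> pd (Wmx X N) -> pd (Wtmx X N).
Proof.
move=> pX pW; have /pdP[hX posX] := pX; have /pdP[_ posW] := pW.
apply/pdP; split; first exact: Wtmx_herm.
move=> v; rewrite -[v]vsubmxK -[usubmx v]vsubmxK Wtmx_form //.
set a := usubmx (usubmx v); set x := dsubmx (usubmx v); set u := dsubmx v => v0.
have /psdP[_ nX] := pd_psd pX; have /psdP[_ nW] := pd_psd pW.
have [e|xu0] := eqVneq (col_mx x u) 0; last by rewrite ltr_wpDl // posW.
move: e; rewrite -col_mx0 => /eq_col_mx[x0 u0].
rewrite ltr_pwDl // x0 u0 !mulmx0 !addr0 posX //.
by apply: contra_neq v0 => ->; rewrite x0 u0 !col_mx0.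
Qed.

Lemma tf_form n m (N : model R n m) (z : C) (u : 'cV[C]_m) :
  ~~ eigenvalue (mA N) z ->
  let x := invmx (z%:M - mA N) *m mB N *m u in
  mA N *m x + mB N *m u = z *: x /\
  rform (adjmx (tf N z) + tf N z) u u =
  2 * rform (mC N) u x + rform (adjmx (mD N) + mD N) u u.
Proof.
rewrite -resolvent_unit => uz x; split.
  have : (z%:M - mA N) *m x = mB N *m u by rewrite /x !mulmxA mulmxV // mul1mx.
  by rewrite mulmxBl mul_scalar_mx => <-; rewrite addrC subrK.
rewrite !rformDm !rform_adj /tf rformDm /x -!mulmxA !rform_mulr -!mulmxA.
by ring.
Qed.

(** For [x = (z - A)^-1 B u] the next state is [z x]; as [|z| = 1], the storage terms cancel and
    only the supply remains. *)
Lemma Wmx_unimodular n m (X : 'M[C]_n) (N : model R n m) (z : C) u :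
  is_hermitian X -> nsq z = 1 -> ~~ eigenvalue (mA N) z ->
  exists x, rform (Wmx X N) (col_mx x u) (col_mx x u) =
    rform (adjmx (tf N z) + tf N z) u u.
Proof.
move=> hX z1 /(tf_form u)[]; set x := invmx _ *m _ *m u => e ->.
by exists x; rewrite Wmx_form // e rform_scale z1 mul1r subrr add0r.
Qed.

Lemma nsq_expi (w : R) : nsq (expi w) = 1.
Proof. by rewrite /nsq /= cos2Dsin2. Qed.

Lemma expi_surj (z : C) : nsq z = 1 -> exists2 w, - pi <= w <= pi & expi w = z.
Proof.
case: z => a b; rewrite /nsq /= => ab.
have a1 : -1 <= a <= 1.
  by rewrite -ler_norml -(ler_pXn2r (ltn0Sn 1)) ?nnegrE // real_normK ?num_real //
     expr1n -ab lerDl sqr_ge0.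
have sa : sin (acos a) = `|b|.
  have bE : 1 - a ^+ 2 = b ^+ 2 by rewrite -ab; ring.
  by rewrite sin_acos // bE sqrtr_sqr.
have p0 := acos_ge0 a1; have p1 := acos_lepi a1.
have [b0|b0] := lerP 0 b.
  exists (acos a); first by rewrite p1 andbT; lra.
  by rewrite /expi acosK ?in_itv //= sa ger0_norm.
exists (- acos a); first by apply/andP; split; lra.
by rewrite /expi cosN sinN acosK ?in_itv //= sa ltr0_norm // opprK.
Qed.

Lemma Wtmx_pd_stable n m (X : 'M[C]_n) (N : model R n m) l :
  is_hermitian X -> pd (Wtmx X N) -> eigenvalue (mA N) l -> `|l| < 1.
Proof.
move=> hX /Wtmx_pd -/(_ hX)[/pdP[_ pX] /pdP[_ pW]] /eigenvalue_colP[v v0 Av].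
have : 0 < rform (Wmx X N) (col_mx v 0) (col_mx v 0).
  by apply: pW; apply: contra_neq v0; rewrite -col_mx0 => /eq_col_mx[->].
rewrite Wmx_form // mulmx0 addr0 Av rform_scale !rform0l mulr0 !addr0 norm_lt1.
by have := pX v v0; nra.
Qed.

Lemma Wtmx_pd_strictly_passive n m (X : 'M[C]_n) (N : model R n m) :
  is_hermitian X -> pd (Wtmx X N) -> strictly_passive N.
Proof.
move=> hX pW; have st := Wtmx_pd_stable hX pW.
split=> // w _; have [_ /pdP[_ pos]] := Wtmx_pd pW hX.
apply/pdP; split; first exact: herm_addadj.
move=> u u0; have ne : ~~ eigenvalue (mA N) (expi w).
  by apply/negP => /st; rewrite norm_lt1 nsq_expi ltxx.
have [x <-] := Wmx_unimodular u hX (nsq_expi w) ne.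
by apply: pos; apply: contra_neq u0; rewrite -col_mx0 => /eq_col_mx[_ ->].
Qed.

Lemma strict_KYP n m (N : model R n m) : (0 < m)%N ->
  strictly_passive N -> exists X, is_hermitian X /\ pd (Wtmx X N).
Proof.
move=> m0 [pos st].
(* On [g = (x, u)], [S] reads the state and [T] the next state; [W], taken at [X = 0], is the supply
   alone. *)
pose S : 'M[C]_(n, n + m) := row_mx 1%:M 0.
pose T : 'M[C]_(n, n + m) := row_mx (mA N) (mB N).
pose W := Wmx 0 N.
have h0 : is_hermitian (0 : 'M[C]_n) by exact: adjmx0.
have SE (x : 'cV[C]_n) (u : 'cV[C]_m) : S *m col_mx x u = x.
  by rewrite mul_row_col mul1mx mul0mx addr0.
have TE (x : 'cV[C]_n) (u : 'cV[C]_m) :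
    T *m col_mx x u = mA N *m x + mB N *m u by rewrite mul_row_col.
have Wpos g z : nsq z = 1 -> T *m g = z *: (S *m g) -> g != 0 -> 0 < rform W g g.
  rewrite -[g]vsubmxK SE TE; set x := usubmx g; set u := dsubmx g => z1 e g0.
  have ne : ~~ eigenvalue (mA N) z.
    by apply/negP => /st; rewrite norm_lt1 z1 ltxx.
  have xE : x = invmx (z%:M - mA N) *m mB N *m u.
    rewrite -mulmxA; apply: (canRL (mulKmx _)); first by rewrite resolvent_unit.
    by rewrite mulmxBl mul_scalar_mx -e addrC addKr.
  (* The state is a function of the input, since [z] is not an eigenvalue. *)
  have u0 : u != 0.
    by apply: contra_neq g0 => u0; rewrite xE u0 !mulmx0 col_mx0.
  rewrite Wmx_form // !rform0m subrr add0r.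
  have [_] := tf_form u ne; rewrite -xE => <-.
  have [w hw <-] := expi_surj z1.
  by have /pdP[_] := pos w hw; apply.
have [|Z pZ Z0 SZT|X [tau [hX tau0 pX]]] := @lmi_alternative R n (n + m) S T W.
- by rewrite addn_gt0 m0 orbT.
- have [G [l [ZE TG l1]]] := psd_decomposition pZ SZT.
  have eigG j : T *m col j G = l 0 j *: (S *m col j G).
    rewrite !colE !mulmxA TG mul_mx_diag -!colE; apply/colP => i.
    by rewrite !mxE mulrC.
  have WE j : 0 <= rform W (col j G) (col j G).
    have [->|g0] := eqVneq (col j G) 0; first by rewrite rform0l.
    by apply/ltW/(Wpos _ (l 0 j)) => //; apply/norm_eq1/l1.
  have ipE : ip W Z = \sum_j rform W (col j G) (col j G).
    rewrite /ip ZE mulmxA mxtrace_mulC mulmxA /mxtrace Re_sum.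
    apply: eq_bigr => j _; rewrite rform.unlock; congr Re.
    rewrite !mxE; apply: eq_bigr => k _; rewrite !mxE; congr (_ * _).
    by apply: eq_bigr => k' _; rewrite !mxE.
  rewrite ipE lt_def sumr_ge0 ?andbT //; apply: contra_neq Z0 => s0.
  rewrite ZE; suff -> : G = 0 by rewrite mul0mx.
  apply/matrixP => i j; rewrite [RHS]mxE.
  have c0 : col j G = 0.
    apply/eqP; apply: contraT => g0.
    have := Wpos (col j G) (l 0 j) _ (eigG j) g0.
    rewrite (psumr_eq0P _ s0) // ltxx => -> //; exact/norm_eq1/l1.
  by have /colP/(_ i) := c0; rewrite !mxE.
have formX x u : col_mx x u != 0 -> 0 < rform X x x -
    rform X (mA N *m x + mB N *m u) (mA N *m x + mB N *m u) +
    tau * (2 * rform (mC N) u x + rform (adjmx (mD N) + mD N) u u).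
  by move=> g0; have := pX _ g0; rewrite SE TE Wmx_form // !rform0m subrr add0r.
have decX : decreasing (mA N) X.
  move=> v v0; have := formX v 0.
  rewrite mulmx0 addr0 !rform0l !(mulr0, addr0) subr_gt0; apply.
  by apply: contra_neq v0; rewrite -col_mx0 => /eq_col_mx[->].
have pdX : pd X by exact: lyapunov_pd st hX decX.
(* With [tau = 0], the vector [(0, u)] would make minus the [X]-form at [B u] positive. *)
have taupos : 0 < tau.
  rewrite lt_def tau0 andbT; apply/eqP => t0.
  pose u : 'cV[C]_m := evec (Ordinal m0) 1.
  have u0 : u != 0.
    apply/eqP => /matrixP/(_ (Ordinal m0) 0); rewrite !mxE !eqxx mulr1n mulr1.
    by move/eqP; rewrite oner_eq0.
  have := formX 0 u; rewrite t0 mul0r addr0 mulmx0 add0r rform0l sub0r oppr_gt0.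
  have /psdP[_ /(_ (mB N *m u))] := pd_psd pdX; rewrite leNgt => /negP h /(_ _) k.
  by apply/h/k; apply: contra_neq u0; rewrite -col_mx0 => /eq_col_mx[_ ->].
pose Y := tau^-1%:C%C *: X.
have hY : is_hermitian Y by exact: hermZ.
exists Y; split=> //; apply: pd_Wtmx; apply/pdP; split=> //.
- move=> v v0; rewrite rformZm mulr_gt0 ?invr_gt0 //.
  by have /pdP[_] := pdX; apply.
- exact: Wmx_herm.
- move=> v; rewrite -[v]vsubmxK => v0; rewrite Wmx_form // !rformZm.
  rewrite -(pmulr_rgt0 _ taupos) mulrDr mulrBr !mulrA mulfV ?gt_eqF // !mul1r.
  exact: formX.
Qed.

End KYP.

(** * Passivity from a non-strict inequality *)

Section Semisimple.
Variable R : realType.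
Local Notation C := (complex R).

Lemma char_poly_block_lower r s (c : C) (M : 'M[C]_(s, r)) (A2 : 'M[C]_s) :
  char_poly (block_mx c%:M 0 M A2) = ('X - c%:P) ^+ r * char_poly A2.
Proof.
rewrite /char_poly /char_poly_mx map_block_mx map_mx0 scalar_mx_block.
rewrite opp_block_mx add_block_mx oppr0 !add0r det_lblock.
by rewrite map_scalar_mx -raddfB det_scalar.
Qed.

Lemma char_poly_conj p (P A B : 'M[C]_p) : P \in unitmx -> P *m A = B *m P ->
  char_poly A = char_poly B.
Proof.
move=> uP PA; have dP : \det (map_mx polyC P) != 0.
  by rewrite det_map_mx polyC_eq0 -unitfE -unitmxE.
apply: (mulfI dP); rewrite /char_poly -det_mulmx [RHS]mulrC -det_mulmx.
congr (\det _); rewrite /char_poly_mx mulmxBr mulmxBl -!map_mxM PA.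
by rewrite mul_scalar_mx mul_mx_scalar.
Qed.

(** In the basis of the rows of [V] and [W] the matrix is block triangular. The sum of the sizes is
    a hypothesis because it is later applied to the ranks of a kernel and its complement. *)
Lemma char_poly_deflate p r s (e : (r + s)%N = p) (A : 'M[C]_p) (c : C)
    (V : 'M[C]_(r, p)) (W : 'M[C]_(s, p)) (M : 'M[C]_(s, r)) (A2 : 'M[C]_s) :
  row_free (col_mx V W) -> V *m A = c *: V -> W *m A = M *m V + A2 *m W ->
  char_poly A = ('X - c%:P) ^+ r * char_poly A2.
Proof.
case: _ / e in A V W *; rewrite row_free_unit => uP VA WA.
rewrite -(char_poly_block_lower _ M); apply: char_poly_conj uP _.
by rewrite mul_block_col mul_scalar_mx mul0mx addr0 -VA -WA mul_col_mx.
Qed.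

(** Splitting off the eigenspace [K] leaves a block [A2] on a complement. If [l] is not an
    eigenvalue of [A2], its algebraic multiplicity is exactly the rank of [K]. *)
Lemma semisimple_row p (A : 'M[C]_p) l :
  (forall u : 'rV[C]_p, u *m (A - l%:M) *m (A - l%:M) = 0 -> u *m (A - l%:M) = 0) ->
  semisimple A l.
Proof.
set B := A - l%:M => hB; set K := kermx B.
have rK : \rank K = (p - \rank B)%N by rewrite mxrank_ker.
pose V := row_base K; pose W := row_base (K^C)%MS.
have rs : (\rank K + \rank (K^C)%MS)%N = p.
  by rewrite mxrank_compl subnKC ?rank_leq_row.
have freeP : row_free (col_mx V W).
  rewrite -row_leq_rank -addsmxE (adds_eqmx (eq_row_base _) (eq_row_base _)).
  have := addsmx_compl_full K; rewrite /row_full => /eqP ->.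
  by rewrite rs.
have VK : (V :=: K)%MS by exact: eq_row_base.
have VB : V *m B = 0 by apply/sub_kermxP; rewrite VK.
have VA : V *m A = l *: V.
  by move/eqP: VB; rewrite mulmxBr mul_mx_scalar subr_eq0 => /eqP.
have fullP : row_full (col_mx V W).
  by rewrite /row_full -addsmxE (adds_eqmx (eq_row_base _) (eq_row_base _));
     exact: addsmx_compl_full.
have /submxP[D WA] : (W *m A <= col_mx V W)%MS by rewrite submx_full.
clearbody V W; rewrite -[D]hsubmxK mul_row_col in WA; set A2 := rsubmx D in WA.
rewrite /semisimple (char_poly_deflate rs freeP VA WA) mupMl.
  by rewrite mup_XsubCX eqxx rK.
rewrite -eigenvalue_root_char; apply/negP => /eigenvalueP[u uA2 u0].
(* An eigenvector [u] of [A2] for [l] lifts to [u W], which [B] sends into [K]. So [B] applied twice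
   kills it, hence [B] does, and [u W] lies both in [K] and in its complement. *)
have uWB : u *m W *m B = u *m lsubmx D *m V.
  rewrite mulmxBr -(mulmxA u W A) WA mulmxDr !mulmxA uA2 mul_mx_scalar -scalemxAl.
  by rewrite addrK.
have /sub_kermxP : u *m W *m B = 0.
  by apply: hB; rewrite uWB -(mulmxA _ V B) VB mulmx0.
rewrite -/K -VK => /submxP[c uW].
have : row_mx (- c) u *m col_mx V W = 0 by rewrite mul_row_col uW mulNmx addNr.
move/eqP; rewrite mulmx_free_eq0 // -row_mx0 => /eqP/eq_row_mx[_ u00].
by rewrite u00 eqxx in u0.
Qed.

Lemma char_poly_tr p (A : 'M[C]_p) : char_poly A^T = char_poly A.
Proof.
by rewrite /char_poly -det_tr /char_poly_mx linearB /= tr_scalar_mx -map_trmx trmxK.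
Qed.

(** On a Jordan chain [A] acts, up to the phase [l], as the shift [v + s w'] to [v + (s + 1) w'],
    and a contraction cannot increase the [X]-form along this line. *)
Lemma contraction_no_jordan p (A X : 'M[C]_p) (l : C) (v w : 'cV[C]_p) : pd X ->
  (forall v, rform X (A *m v) (A *m v) <= rform X v v) -> nsq l = 1 ->
  A *m w = l *: w -> A *m v = l *: v + w -> w = 0.
Proof.
move=> pX contr l1 Aw Av; have /pdP[hX posX] := pX.
have l0 : l != 0.
  by apply: contra_eq_neq l1 => ->; rewrite /nsq /= expr0n addr0 eq_sym oner_eq0.
have [w' lw' Aw'] : exists2 w', l *: w' = w & A *m w' = w.
  exists (l^-1 *: w); first by rewrite scalerA mulfV // scale1r.
  by rewrite -scalemxAr Aw scalerA mulVf // scale1r.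
have step (s : R) : rform X (v + (s + 1)%:C%C *: w') (v + (s + 1)%:C%C *: w') <=
    rform X (v + s%:C%C *: w') (v + s%:C%C *: w').
  have E : A *m (v + s%:C%C *: w') = l *: (v + (s + 1)%:C%C *: w').
    rewrite mulmxDr Av -scalemxAr Aw' scalerDr -addrA; congr (_ + _).
    rewrite rmorphD rmorph1 scalerDl scale1r scalerDr addrC lw' scalerA.
    by rewrite [in RHS]mulrC -scalerA lw'.
  by have := contr (v + s%:C%C *: w'); rewrite E rform_scale l1 mul1r.
apply/eqP; apply: contraT => w0.
have w'0 : w' != 0 by apply: contra_neq w0 => w'0; rewrite -lw' w'0 scaler0.
have := posX _ w'0; set q := rform X w' w' => q0.
(* The vertex of the parabola in [s], from which a unit step increases the form by [q > 0]. *)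
have := step (- (rform X v w' / q)).
rewrite !rformDl !rformDr !(rformZl, rformZr) (rformC w' v hX) -/q.
move: (rform X v w') => b h.
have e : q * (b / q) = b by rewrite mulrC divfK // gt_eqF.
move: (b / q) e h => t e h; nra.
Qed.

Lemma contraction_semisimple p (A X : 'M[C]_p) l : pd X ->
  (forall v, rform X (A *m v) (A *m v) <= rform X v v) -> `|l| = 1 ->
  semisimple A l.
Proof.
move=> pX contr /norm_eq1 l1; have /pdP[hX posX] := pX.
suff : semisimple A^T l.
  rewrite /semisimple char_poly_tr => ->; congr (_ - _)%N.
  by rewrite -[in RHS]mxrank_tr linearB /= tr_scalar_mx.
apply: semisimple_row => u uBB; set B := A - l%:M.
have BT : A^T - l%:M = B^T by rewrite linearB /= tr_scalar_mx.
rewrite BT in uBB *; apply: trmx_inj; rewrite trmx0 trmx_mul trmxK.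
set v := u^T; set w := B *m v.
have Bw : B *m w = 0.
  by apply: trmx_inj; rewrite trmx0 !trmx_mul /v trmxK.
have Aw : A *m w = l *: w.
  by move/eqP: Bw; rewrite mulmxBl mul_scalar_mx subr_eq0 => /eqP.
have Av : A *m v = l *: v + w.
  by rewrite /w mulmxBl mul_scalar_mx addrC subrK.
exact: contraction_no_jordan pX contr l1 Aw Av.
Qed.

Lemma Wtmx_psd_passive n m (X : 'M[C]_n) (N : model R n m) :
  pd X -> psd (Wtmx X N) -> passive N.
Proof.
move=> pX pW; have /pdP[hX posX] := pX.
have [_ /psdP[_ pos]] := Wtmx_psd pW hX.
have contr v : rform X (mA N *m v) (mA N *m v) <= rform X v v.
  have := pos (col_mx v 0); rewrite Wmx_form // mulmx0 addr0 !rform0l mulr0 !addr0.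
  by rewrite subr_ge0.
split=> [w _ /negP ne|].
  apply/psdP; split; first exact: herm_addadj.
  move=> u; have [x <-] := Wmx_unimodular u hX (nsq_expi w) ne; exact: pos.
split=> l el; last exact: contraction_semisimple pX contr.
have [v v0 Av] := eigenvalue_colP el.
rewrite norm_le1; have := contr v; rewrite Av rform_scale.
by have := posX v v0; nra.
Qed.

End Semisimple.

(** * The extremal parameter *)

Section Main.
Variable R : realType.
Local Notation C := (complex R).

(** The diagonal blocks [X] carry no factor in the model at [xi]; writing [X] as
    [(X - xi X) / (1 - xi)] produces the blocks [X] of [diagXX2]. The block [2] comes from [- xi]
    occurring in both [D] and its adjoint. *)
Lemma Wtmx_model_xi n m (X : 'M[C]_n) (M : model R n m) (xi : R) : xi < 1 ->
  Wtmx X (model_xi M xi) =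
  (1 - xi)^-1%:C%C *: (Wtmx X M - xi%:C%C *: diagXX2 m X).
Proof.
move=> xi1; have c0 : 1 - xi != 0 by rewrite gt_eqF // subr_gt0.
set c := (1 - xi)^-1.
have XE : X = c%:C%C *: (X - xi%:C%C *: X).
  rewrite -{2}[X]scale1r -scalerBl scalerA -(rmorph1 (real_complex R)) -rmorphB.
  by rewrite -rmorphM mulVf // rmorph1 scale1r.
rewrite /Wtmx /diagXX2 /= !scale_block_mx !scaler0 !opp_block_mx !add_block_mx.
rewrite !oppr0 !addr0 !scale_block_mx scale_col_mx scale_row_mx.
rewrite !adjmxZr -!scalemxAr -!scalemxAl -XE; congr block_mx.
rewrite -scalerDr; congr (_ *: _).
rewrite adjmxB adjmx_scalar_real addrACA -opprD; congr (_ - _).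
by rewrite scale_scalar_mx mulr_natr mulr2n raddfD.
Qed.

Lemma pdZ p (c : R) (X : 'M[C]_p) : 0 < c -> pd X -> pd (c%:C%C *: X).
Proof.
move=> c0 /pdP[hX pX]; apply/pdP; split=> [|v v0]; first exact: hermZ.
by rewrite rformZm mulr_gt0 // pX.
Qed.

Lemma psd_pdD p (X Y : 'M[C]_p) : psd X -> pd Y -> pd (X + Y).
Proof.
move=> /psdP[hX pX] /pdP[hY pY]; apply/pdP; split=> [|v v0]; first exact: hermD.
by rewrite rformDm ltr_wpDl // pY.
Qed.

Lemma scale_cancel p (c : R) (Y : 'M[C]_p) : c != 0 ->
  Y = c%:C%C *: (c^-1%:C%C *: Y).
Proof. by move=> c0; rewrite scalerA -rmorphM mulfV // rmorph1 scale1r. Qed.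

Lemma pd_scaleV p (c : R) (Y : 'M[C]_p) : 0 < c ->
  pd (c^-1%:C%C *: Y) <-> pd Y.
Proof.
move=> c0; split=> h; last by apply: pdZ h; rewrite invr_gt0.
by rewrite (scale_cancel Y (lt0r_neq0 c0)); exact: pdZ c0 h.
Qed.

Lemma psd_scaleV p (c : R) (Y : 'M[C]_p) : 0 < c ->
  psd (c^-1%:C%C *: Y) <-> psd Y.
Proof.
move=> c0; split=> h; last by apply: psdZ h; rewrite invr_ge0 ltW.
by rewrite (scale_cancel Y (lt0r_neq0 c0)); exact: psdZ (ltW c0) h.
Qed.

Lemma pd_model_xi n m (X : 'M[C]_n) (M : model R n m) (xi : R) : xi < 1 ->
  pd (Wtmx X (model_xi M xi)) <-> pd (Wtmx X M - xi%:C%C *: diagXX2 m X).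
Proof.
move=> xi1; rewrite (Wtmx_model_xi X M xi1); apply: pd_scaleV.
by rewrite subr_gt0.
Qed.

Lemma psd_model_xi n m (X : 'M[C]_n) (M : model R n m) (xi : R) : xi < 1 ->
  psd (Wtmx X (model_xi M xi)) <-> psd (Wtmx X M - xi%:C%C *: diagXX2 m X).
Proof.
move=> xi1; rewrite (Wtmx_model_xi X M xi1); apply: psd_scaleV.
by rewrite subr_gt0.
Qed.

Lemma diagXX2_psd n m (X : 'M[C]_n) : psd X -> psd (diagXX2 m X).
Proof.
move=> /psdP[hX pX]; apply/psdP; split; first exact: diagXX2_herm.
move=> v; rewrite -[v]vsubmxK -[usubmx v]vsubmxK diag_form.
by rewrite !addr_ge0 ?mulr_ge0 ?sqn_ge0.
Qed.

Lemma diagXX2_pd n m (X : 'M[C]_n) : pd X -> pd (diagXX2 m X).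
Proof.
move=> pX; have /pdP[hX posX] := pX; have /psdP[_ X0] := pd_psd pX.
apply/pdP; split; first exact: diagXX2_herm.
move=> v; rewrite -[v]vsubmxK -[usubmx v]vsubmxK diag_form.
set a := usubmx (usubmx v); set x := dsubmx (usubmx v); set u := dsubmx v => v0.
have := X0 a; have := X0 x; have := sqn_ge0 u.
have [a0|/posX] := eqVneq a 0; last by lra.
have [x0|/posX] := eqVneq x 0; last by lra.
have [u0|/sqn_gt0] := eqVneq u 0; last by lra.
by move: v0; rewrite a0 x0 u0 !col_mx0 eqxx.
Qed.

Lemma lmi_shift n m (X : 'M[C]_n) (M : model R n m) (xi eta : R) :
  Wtmx X M - eta%:C%C *: diagXX2 m X =
  (xi - eta)%:C%C *: diagXX2 m X + (Wtmx X M - xi%:C%C *: diagXX2 m X).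
Proof. by rewrite rmorphB scalerBl [RHS]addrC addrA subrK. Qed.

Lemma lmi_psd_le n m (X : 'M[C]_n) (M : model R n m) (xi eta : R) :
  psd X -> eta <= xi -> psd (Wtmx X M - xi%:C%C *: diagXX2 m X) ->
  psd (Wtmx X M - eta%:C%C *: diagXX2 m X).
Proof.
rewrite (lmi_shift _ _ xi eta) -subr_ge0 => pX le; apply: psdD.
exact: psdZ le (diagXX2_psd m pX).
Qed.

Lemma lmi_pd_lt n m (X : 'M[C]_n) (M : model R n m) (xi eta : R) :
  pd X -> eta < xi -> psd (Wtmx X M - xi%:C%C *: diagXX2 m X) ->
  pd (Wtmx X M - eta%:C%C *: diagXX2 m X).
Proof.
rewrite (lmi_shift _ _ xi eta) -subr_gt0 => pX lt h; rewrite addrC.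
exact: psd_pdD h (pdZ lt (diagXX2_pd m pX)).
Qed.

Lemma lmi0 n m (X : 'M[C]_n) (M : model R n m) :
  Wtmx X M - 0%:C%C *: diagXX2 m X = Wtmx X M.
Proof. by rewrite rmorph0 scale0r subr0. Qed.

Lemma sp_setP n m (M : model R n m) (xi : R) : (0 < m)%N ->
  sp_set M xi <-> xi < 1 /\
    exists X, pd X /\ pd (Wtmx X M - xi%:C%C *: diagXX2 m X).
Proof.
move=> m0; split=> [[xi1 /(strict_KYP m0)[X [hX pX]]]|[xi1 [X [pX pW]]]].
  split=> //; exists X; split; first by have [] := Wtmx_pd pX hX.
  by move/(pd_model_xi X M xi1): pX.
split=> //; have /pdP[hX _] := pX.
by apply: (Wtmx_pd_strictly_passive hX); apply/(pd_model_xi X M xi1).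
Qed.

(** * A priori bounds on solutions of the inequality *)

Lemma lmi_state_bound n m (X : 'M[C]_n) (M : model R n m) k x :
  psd X -> psd (Wtmx X M) ->
  rform X (mA M ^+ k *m x) (mA M ^+ k *m x) <= rform X x x.
Proof.
move=> /psdP[hX _] /Wtmx_psd -/(_ hX)[_ /psdP[_ pW]].
elim: k => [|k IH]; first by rewrite expr0 mul1mx.
apply: le_trans IH; rewrite exprS -mulmxE -mulmxA; set y := _ *m x.
have := pW (col_mx y 0); rewrite Wmx_form // mulmx0 addr0 !rform0l mulr0 !addr0.
by rewrite subr_ge0.
Qed.

(** Independent of [X], hence the source of all bounds uniform in [X]. *)
Definition feedthrough n m (M : model R n m) (u : 'cV[C]_m) : R :=
  rform (adjmx (mD M) + mD M) u u.

Lemma lmi_input_bound n m (X : 'M[C]_n) (M : model R n m) u :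
  psd X -> psd (Wtmx X M) -> rform X (mB M *m u) (mB M *m u) <= feedthrough M u.
Proof.
move=> /psdP[hX _] /Wtmx_psd -/(_ hX)[_ /psdP[_ pW]].
have := pW (col_mx 0 u); rewrite Wmx_form // mulmx0 add0r rform0l rform0r.
by rewrite mulr0 !add0r addrC subr_ge0.
Qed.

(** Cauchy-Schwarz between the second and third block coordinates: [C] is the off-diagonal entry,
    [(1 - xi) X] and [D^* + D - 2 xi] the diagonal ones. The factor [1 - xi] makes outputs vanish as
    [xi] tends to [1]. *)
Lemma lmi_output_bound n m (X : 'M[C]_n) (M : model R n m) (xi : R) x u :
  psd X -> 0 <= xi <= 1 -> psd (Wtmx X M - xi%:C%C *: diagXX2 m X) ->
  rform (mC M) u x ^+ 2 <= (1 - xi) * rform X x x * feedthrough M u.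
Proof.
move=> /psdP[hX pX] /andP[xi0 xi1] pP.
pose e1 : 'cV[C]_(n + n + m) := col_mx (col_mx 0 x) 0.
pose e2 : 'cV[C]_(n + n + m) := col_mx (col_mx 0 0) u.
have := rform_CS e1 e2 pP; rewrite !rformBm !rformZm /e1 /e2 !diag_form.
rewrite /diagXX2 /Wtmx !rform_block !rform_col !rform_row.
rewrite !(rform0l, rform0r, rform0m) !rform_adj !(addr0, add0r, mulr0, subr0).
rewrite /sqn !rform0l mulr0 addr0 -/(sqn u) => h; apply: le_trans h _.
have := mulr_ge0 xi0 (sqn_ge0 u); have := pX x; rewrite /feedthrough.
move: (rform X x x) (rform _ u u) (sqn u) => a b s a0 s0.
have : 0 <= (1 - xi) * a by rewrite mulr_ge0 // subr_ge0.
by nra.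
Qed.

Lemma observable_kernel n m (A : 'M[C]_n) (Cm : 'M[C]_(m, n)) q (Y : 'M[C]_(n, q)) :
  observable A Cm -> (forall k, Cm *m A ^+ k *m Y = 0) -> Y = 0.
Proof.
move=> /eqP obs h; have /row_full_inj inj : row_full (\mxcol_(i < n) (Cm *m A ^+ i)).
  exact: obs.
apply: inj; rewrite mulmx0 mxcol_mul; apply/mxcolP => i.
by rewrite mxcolK submxcol0 h.
Qed.

Lemma controllable_right_inverse n m (A : 'M[C]_n) (B : 'M[C]_(n, m)) :
  controllable A B -> exists Y, \mxrow_(i < n) (A ^+ i *m B) *m Y = 1%:M.
Proof. by move=> /eqP ctr; apply/row_freeP; exact: ctr. Qed.

Lemma controllable_image n m (A : 'M[C]_n) (B : 'M[C]_(n, m)) q (Y : 'M[C]_(q, n)) :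
  controllable A B -> (forall k, Y *m (A ^+ k *m B) = 0) -> Y = 0.
Proof.
move=> /controllable_right_inverse[K hK] h.
rewrite -[Y]mulmx1 -hK mulmxA mul_mxrow.
rewrite (_ : \mxrow_j _ = 0) ?mul0mx //; apply/mxrowP => i.
by rewrite mxrowK submxrow0 h.
Qed.

(** If the form vanishes at [v], it vanishes at every [A^k v], and the output bound at [xi = 0] then
    gives [C A^k v = 0]. *)
Lemma observable_pd n m (X : 'M[C]_n) (M : model R n m) :
  observable (mA M) (mC M) -> psd X -> psd (Wtmx X M) -> pd X.
Proof.
move=> obs pX pW; have /psdP[hX X0] := pX; apply/pdP; split=> // v v0.
rewrite lt_def X0 andbT; apply: contra_neq v0 => Xv.
apply: (observable_kernel obs) => k; apply: sqn_eq0.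
set x := mA M ^+ k *m v.
have Xx : rform X x x = 0.
  by apply/eqP; rewrite eq_le X0 andbT -Xv lmi_state_bound.
have := @lmi_output_bound n m X M 0 x (mC M *m x) pX; rewrite lexx ler01 lmi0.
move=> /(_ isT pW); rewrite Xx mulr0 mul0r -mulmxA -/x => h.
have : rform (mC M) (mC M *m x) x = 0.
  by apply/eqP; rewrite -sqrf_eq0 eq_le h sqr_ge0.
by rewrite /sqn -rform_mulr mul1mx.
Qed.

(** Iterates the bound of the form at [a + b] by twice the sum of its values. The constant is crude,
    but free of [X]. *)
Lemma rform_sum_le n (X : 'M[C]_n) (I : Type) (s : seq I) (a : I -> 'cV[C]_n) :
  psd X -> rform X (\sum_(i <- s) a i) (\sum_(i <- s) a i) <=
           2 ^+ size s * \sum_(i <- s) rform X (a i) (a i).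
Proof.
move=> pX; have /psdP[hX X0] := pX.
elim: s => [|i s IH]; first by rewrite !big_nil rform0l mulr0.
rewrite !big_cons /=; set S := \sum_(j <- s) a j in IH *.
set T := \sum_(j <- s) _ in IH *.
have T0 : 0 <= T by apply: sumr_ge0.
have p1 : 1 <= (2 : R) ^+ size s by rewrite exprn_ege1 // ler1n.
rewrite rformDl !rformDr (rformC S (a i) hX) exprS.
have := rform_young (a i) S pX; have := X0 (a i).
move: (rform X (a i) (a i)) (rform X (a i) S) (rform X S S) (2 ^+ size s) IH p1.
move=> x y z w *; nra.
Qed.

(** Each basis vector is a sum of terms [A^j B y] with inputs [y] chosen from [(A, B)] alone; the
    state and input bounds control each term by [feedthrough]. *)
Lemma controllable_bound n m (M : model R n m) : controllable (mA M) (mB M) ->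
  exists K : R, forall X, psd X -> psd (Wtmx X M) ->
    forall i, complex.Re (X i i) <= K.
Proof.
move=> /controllable_right_inverse[Y hY].
pose y i (j : 'I_n) : 'cV[C]_m := submxcol (Y *m evec i 1) j.
pose F i := 2 ^+ size (index_enum 'I_n) * \sum_j feedthrough M (y i j).
exists (\sum_i `|F i|) => X pX pW i.
have eE : evec i 1 = \sum_(j < n) (mA M ^+ j *m (mB M *m y i j)).
  rewrite -[LHS]mul1mx -hY -mulmxA -[Y *m _]submxcolK mul_mxrow_mxcol.
  by apply: eq_bigr => j _; rewrite mulmxA.
have XF : complex.Re (X i i) <= F i.
  rewrite Re_form_evec eE; apply: le_trans (rform_sum_le _ _ pX) _.
  rewrite ler_wpM2l ?exprn_ge0 //; apply: ler_sum => j _.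
  by apply: le_trans (lmi_state_bound _ _ pX pW) _; exact: lmi_input_bound.
apply: le_trans XF _; apply: le_trans (ler_norm _) _.
by rewrite (bigD1 i) //= lerDl sumr_ge0.
Qed.

Lemma model_xi0 n m (M : model R n m) : model_xi M 0 = M.
Proof.
case: M => A B Cm D; rewrite /model_xi /= subr0 invr1 rmorph1 !scale1r.
by rewrite rmorph0 subr0.
Qed.

Lemma sp_set0 n m (M : model R n m) : strictly_passive M -> sp_set M 0.
Proof. by move=> sM; split; [exact: ltr01|rewrite model_xi0]. Qed.

Lemma has_sup_sp_set n m (M : model R n m) : strictly_passive M ->
  has_sup (sp_set M).
Proof.
by move=> /sp_set0 s0; split; [exists 0|exists 1 => x [/ltW]].
Qed.

Lemma Xi_ge0 n m (M : model R n m) : strictly_passive M -> 0 <= Xi M.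
Proof.
by move=> sM; apply: sup_upper_bound; [exact: has_sup_sp_set|exact: sp_set0].
Qed.

Lemma sp_set_near_Xi n m (M : model R n m) (e : R) : (0 < m)%N ->
  strictly_passive M -> 0 < e ->
  exists xi X, [/\ 0 <= xi < 1, Xi M - e < xi, pd X &
                   pd (Wtmx X M - xi%:C%C *: diagXX2 m X)].
Proof.
move=> m0 sM e0; have [x Sx hx] := sup_adherent e0 (has_sup_sp_set sM).
(* Raising the parameter to at least [0] ensures that a solution also satisfies the inequality for
   [M] itself. *)
have : sp_set M (Num.max x 0).
  by case: (leP x 0) => _; [exact: sp_set0 sM|exact: Sx].
move=> /(sp_setP _ _ m0)[x1 [X [pX pW]]]; exists (Num.max x 0), X; split=> //.
  by rewrite x1 le_max lexx orbT.
by rewrite lt_max hx.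
Qed.

Lemma Xi_lt1 n m (M : model R n m) : (0 < n)%N -> (0 < m)%N ->
  strictly_passive M -> minimal M -> Xi M < 1.
Proof.
move=> n0 m0 sM [ctr obs].
have le1 : Xi M <= 1.
  by apply: ge_sup; [case: (has_sup_sp_set sM)|move=> x [/ltW]].
rewrite lt_def le1 andbT eq_sym; apply/eqP => Xi1.
(* The solution [X] varies with [e], but the bound does not mention it; [e] dominates [1 - xi]
   because [Xi = 1]. *)
have small k w u (e : R) : 0 < e ->
    rform (mC M) u (mA M ^+ k *m (mB M *m w)) ^+ 2 <=
    e * (feedthrough M w * feedthrough M u).
  move=> e0; have [xi [X [/andP[xi0 xi1] hxi pX pP]]] := sp_set_near_Xi m0 sM e0.
  have psX := pd_psd pX; have psP := pd_psd pP.
  have pW : psd (Wtmx X M) by rewrite -lmi0; exact: lmi_psd_le psP.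
  have := lmi_output_bound (mA M ^+ k *m (mB M *m w)) u psX _ psP.
  rewrite xi0 ltW // => /(_ isT) h; apply: le_trans h _.
  have /psdP[_ X0] := psX.
  have b1 := lmi_state_bound k (mB M *m w) psX pW.
  have b2 := lmi_input_bound w psX pW.
  have b3 := le_trans (X0 _) (lmi_input_bound u psX pW).
  rewrite mulrA ler_wpM2r //; apply: ler_pM; first by rewrite subr_ge0 ltW.
  - exact: X0.
  - by rewrite Xi1 in hxi; lra.
  - exact: le_trans b1 b2.
have zero k : mC M *m mA M ^+ k *m mB M = 0.
  apply/row_matrixP => i; rewrite row0; apply/rowP => j.
  pose w : 'cV[C]_m := evec j 1; pose x := mA M ^+ k *m (mB M *m w).
  have : sqn (mC M *m x) = 0.
    rewrite /sqn -rform_mulr mul1mx; set q := rform _ _ _.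
    set B := feedthrough M w * feedthrough M (mC M *m x).
    apply/eqP; rewrite -sqrf_eq0; apply: contraT => q0.
    have qp : 0 < q ^+ 2 by rewrite lt_def q0 sqr_ge0.
    (* With [e = q^2 / (2 (|B| + 1))] the estimate becomes [q^2 <= e B < q^2]. *)
    have d0 : 0 < 2 * (`|B| + 1) by rewrite mulr_gt0 // ltr_wpDl.
    have := small k w (mC M *m x) _ (divr_gt0 qp d0); rewrite -/x -/q -/B.
    have BB := ler_norm B; have B0 := normr_ge0 B.
    rewrite mulrAC ler_pdivlMr //.
    by move: (q ^+ 2) (`|B|) qp BB B0 => t b; nra.
  move/sqn_eq0/colP/(_ i).
  rewrite /x !mulmxA /w /evec scale1r -colE !mxE.
  by move=> e; rewrite -[RHS]e.
(* Controllability removes [B] from the vanishing products; observability then removes [C] and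
   leaves [1 = 0]. *)
have A0 k : mC M *m mA M ^+ k = 0.
  apply: (controllable_image ctr) => j.
  by rewrite mulmxA -(mulmxA (mC M)) mulmxE -exprD zero.
have : (1%:M : 'M[C]_n) = 0.
  by apply: (observable_kernel obs) => k; rewrite A0 mul0mx.
move/matrixP/(_ (Ordinal n0) (Ordinal n0)); rewrite !mxE eqxx => /eqP.
by rewrite oner_eq0.
Qed.

(** Solutions for parameters tending to [Xi] are bounded by [controllable_bound]; their limit may be
    singular until [observable_pd] is applied. *)
Lemma lmi_at_Xi n m (M : model R n m) : (0 < m)%N ->
  strictly_passive M -> minimal M ->
  exists X, pd X /\ psd (Wtmx X M - (Xi M)%:C%C *: diagXX2 m X).
Proof.
move=> m0 sM [ctr obs].
have [K hK] := controllable_bound ctr.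
have [F hF] : {F : nat -> 'M[C]_n & forall k, [/\ psd (F k), psd (Wtmx (F k) M) &
    psd (Wtmx (F k) M - (Xi M - k.+1%:R^-1)%:C%C *: diagXX2 m (F k))]}.
  have h k : {X : 'M[C]_n | [/\ psd X, psd (Wtmx X M) &
      psd (Wtmx X M - (Xi M - k.+1%:R^-1)%:C%C *: diagXX2 m X)]}.
    apply: cid; have e0 : 0 < (k.+1%:R^-1 : R) by rewrite invr_gt0.
    have [xi [X [/andP[xi0 _] hxi pX /pd_psd pP]]] := sp_set_near_Xi m0 sM e0.
    have psX := pd_psd pX; exists X; split; first exact: psX.
      by rewrite -lmi0; exact: lmi_psd_le psX xi0 pP.
    exact: lmi_psd_le psX (ltW hxi) pP.
  by exists (fun k => sval (h k)) => k; exact: (svalP (h k)).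
have [U [UU ooU]] := ultrafilter_nat.
have bd k i j : `|complex.Re (F k i j)| <= K /\ `|complex.Im (F k i j)| <= K.
  by have [pF pW _] := hF k; exact: psd_entries_bounded pF (hK _ pF pW) i j.
have [X FX] := @bounded_mcvg R U UU _ _ F K (fun k i j => (bd k i j).1)
  (fun k i j => (bd k i j).2).
have psX : psd X by apply: mcvg_psd FX _ => k; case: (hF k).
have FW : mcvg U (fun k => Wtmx (F k) M) (Wtmx X M).
  have cst := mcvg_cst (U := U).
  apply: mcvg_block; [apply: mcvg_block|apply: mcvg_col|apply: mcvg_row|exact: cst];
    rewrite //; try exact: cst; by apply: mcvgM => //; exact: cst.
have FD : mcvg U (fun k => diagXX2 m (F k)) (diagXX2 m X).
  have cst := mcvg_cst (U := U).
  by apply: mcvg_block; [apply: mcvg_block|..]; rewrite //; exact: cst.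
have Fxi : ccvg U (fun k => (Xi M - k.+1%:R^-1)%:C%C) (Xi M)%:C%C.
  split; last exact: cvg_cst.
  rewrite /= -[X in _ --> X]subr0; apply: cvgB; first exact: cvg_cst.
  by move=> V hV; apply: ooU; exact: cvg_harmonic hV.
have pP : psd (Wtmx X M - (Xi M)%:C%C *: diagXX2 m X).
  by apply: (mcvg_psd (mcvgB FW (mcvgZ Fxi FD))) => k; case: (hF k).
have pW : psd (Wtmx X M) by apply: mcvg_psd FW _ => k; case: (hF k).
by exists X; split; [exact: observable_pd obs psX pW|exact: pP].
Qed.

(** Testing on [(e, 0, 0)] gives [xi <= 1]. If [xi] exceeded [Xi], any parameter strictly between
    would be strictly feasible and below [1], hence in [sp_set M]. *)
Lemma lmi_le_Xi n m (M : model R n m) (X : 'M[C]_n) (xi : R) :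
  (0 < n)%N -> (0 < m)%N -> strictly_passive M -> pd X ->
  psd (Wtmx X M - xi%:C%C *: diagXX2 m X) -> xi <= Xi M.
Proof.
move=> n0 m0 sM pX pP; have /pdP[hX posX] := pX.
have xi1 : xi <= 1.
  pose e : 'cV[C]_n := evec (Ordinal n0) 1.
  have e0 : e != 0.
    apply/eqP => /matrixP/(_ (Ordinal n0) 0); rewrite !mxE !eqxx mulr1n mulr1.
    by move/eqP; rewrite oner_eq0.
  have /psdP[_ /(_ (col_mx (col_mx e 0) 0))] := pP.
  rewrite rformBm rformZm diag_form Wtmx_form // !mulmx0 !addr0 col_mx0 rform0l.
  rewrite /sqn !rform0l mulr0 !addr0 -{1}[rform X e e]mul1r -mulrBl.
  by rewrite pmulr_lge0 ?posX // subr_ge0.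
rewrite leNgt; apply/negP => lt.
have [y /andP[y1 y2]] : exists y, Xi M < y < xi.
  by exists ((Xi M + xi) / 2); apply/andP; split; lra.
have : sp_set M y.
  apply/(sp_setP _ _ m0); split; first exact: lt_le_trans xi1.
  by exists X; split; [exact: pX|exact: lmi_pd_lt pX y2 pP].
move/(sup_upper_bound (has_sup_sp_set sM)); rewrite -/(Xi M).
by rewrite leNgt y1.
Qed.

End Main.

Theorem theorem5p4 (R : realType) (n m : nat) (M : model R n m) :
  (0 < n)%N -> (0 < m)%N ->
  strictly_passive M -> minimal M ->
  has_sup (sp_set M) /\
  passive (model_xi M (Xi M)) /\
  (exists X : 'M[complex R]_n, is_hermitian X /\ psd (Wtmx X (model_xi M (Xi M)))) /\
  ~ (exists X : 'M[complex R]_n, is_hermitian X /\ pd (Wtmx X (model_xi M (Xi M)))) /\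
  (forall xi : R, xi < Xi M ->
     exists X : 'M[complex R]_n, is_hermitian X /\ pd (Wtmx X (model_xi M xi))) /\
  Xi M = sup (xi_star M @` Xgt M).
Proof.
move=> n0 m0 sM minM.
have hs := has_sup_sp_set sM; have lt1 := Xi_lt1 n0 m0 sM minM.
have [X [pX pP]] := lmi_at_Xi m0 sM minM; have /pdP[hX _] := pX.
have psW : psd (Wtmx X (model_xi M (Xi M))) by apply/(psd_model_xi X M lt1).
split; first exact: hs.
split; first exact: Wtmx_psd_passive pX psW.
split; first by exists X; split; [exact: hX|exact: psW].
split.
  move=> [Y [hY pY]]; have [pdY _] := Wtmx_pd pY hY.
  move: pY => /(pd_model_xi Y M lt1) pY.
  (* A strict solution at [Xi] would survive at [Xi + e], beyond the supremum. *)
  have [e e0 he] := pd_sub pY (diagXX2_herm m hY).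
  have /pd_psd : pd (Wtmx Y M - (Xi M + e)%:C%C *: diagXX2 m Y).
    by rewrite rmorphD scalerDl opprD addrA; apply: he; rewrite lexx ltW.
  by move/(lmi_le_Xi n0 m0 sM pdY); rewrite gerDl leNgt e0.
split.
  move=> xi lt; exists X; split; first exact: hX.
  apply/(pd_model_xi X M (lt_trans lt lt1)); exact: lmi_pd_lt pX lt pP.
have star_ub Y : Xgt M Y ->
    ubound [set xi | psd (Wtmx Y M - xi%:C%C *: diagXX2 m Y)] (Xi M).
  by move=> [_ [_ pY]] xi; exact: lmi_le_Xi.
have star_le Y : Xgt M Y -> xi_star M Y <= Xi M.
  (* The set defining [xi_star] is nonempty, as it contains [0] for every member of [Xgt M]. *)
  move=> XY; apply: ge_sup (star_ub _ XY); exists 0 => /=.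
  by rewrite lmi0; case: XY => _ [pW pY]; exact: psd_Wtmx (pd_psd pY) pW.
have XX : Xgt M X.
  have : psd (Wtmx X M).
    by rewrite -lmi0; exact: lmi_psd_le (pd_psd pX) (Xi_ge0 sM) pP.
  move=> /Wtmx_psd -/(_ hX)[_ pW]; split; first exact: hX.
  by split; [exact: pW|exact: pX].
apply/eqP; rewrite eq_le; apply/andP; split.
  (* The supremum over [Xgt M] is attained at the solution [X] found at [Xi]. *)
  have ge : Xi M <= xi_star M X.
    by apply: ub_le_sup pP; exists (Xi M); exact: star_ub.
  apply: le_trans ge _; apply: ub_le_sup; last by exists X.
  by exists (Xi M) => _ [Y XY <-]; exact: star_le.
apply: ge_sup; first by exists (xi_star M X), X.
by move=> _ [Y XY <-]; exact: star_le.
Qed.
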